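(* Suppose that the weight sequence $\{M_p\}_{p\in\mathbb{N}}$ satisfies $(M.1)$, $(M.2)'$, and $(M.3)'$, and let $\ast$ stand for $(M_p)$ (Beurling case) or $\{M_p\}$ (Roumieu case). An ultradistribution $f\in\mathcal{D}'^{\ast}(\mathbb{R})$ satisfies the moment asymptotic expansion (MAE) in $\mathcal{D}'^{\ast}(\mathbb{R})$ if and only if $f\in\mathcal{K}'^{\ast}(\mathbb{R})$.
   Context: $\{M_p\}_{p\in\mathbb{N}}$ is a sequence of positive real numbers ($0\in\mathbb{N}$). Conditions: - $(M.1)$: $M_p^2\le M_{p-1}M_{p+1}$ for $p\ge1$. - $(M.2)'$: $M_{p+1}\le AH^pM_p$, $p\in\mathbb{N}$, for certain constants $A,H$. - $(M.3)'$: $\sum_{p=1}^\infty M_{p-1}/M_p<\infty$. Ultradistributions. For $K\subset\mathbb{R}$ a (regular) compact set and $\ell>0$, $\mathcal{D}^{M_p,\ell}_K$ is the space of smooth $\varphi$ supported in $K$ with $\sup_{m\in\mathbb{N}}\sup_{x\in K}\frac{|\varphi^{(m)}(x)|}{\ell^{m}M_m}<\infty$. Then $\mathcal{D}^{(M_p)}(\mathbb{R})=\varinjlim_{K\Subset\mathbb{R}}\varprojlim_{\ell\to0^+}\mathcal{D}^{M_p,\ell}_K$ and $\mathcal{D}^{\{M_p\}}(\mathbb{R})=\varinjlim_{K\Subset\mathbb{R}}\varinjlim_{\ell\to\infty}\mathcal{D}^{M_p,\ell}_K$. The strong dual of $\mathcal{D}^{\ast}(\mathbb{R})$ is $\mathcal{D}'^{\ast}(\mathbb{R})$.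 The space $\mathcal{K}^{\ast}(\mathbb{R})$. For $q\in\mathbb{N}$ and $\ell>0$, $\mathcal{K}^{M_p,\ell}_q(\mathbb{R})$ is the Banach space of all smooth functions $\varphi$ on $\mathbb{R}$ with $$\|\varphi\|_{\mathcal{K}^{M_p,\ell}_q(\mathbb{R})}=\sup_{m\in\mathbb{N}}\sup_{x\in\mathbb{R}}\frac{(1+|x|)^{m-q}|\varphi^{(m)}(x)|}{\ell^{m}M_m}<\infty.$$ Then $\mathcal{K}^{(M_p)}_q(\mathbb{R})=\varprojlim_{\ell\to0^+}\mathcal{K}^{M_p,\ell}_q(\mathbb{R})$, $\mathcal{K}^{\{M_p\}}_q(\mathbb{R})=\varinjlim_{\ell\to\infty}\mathcal{K}^{M_p,\ell}_q(\mathbb{R})$, and $\mathcal{K}^{\ast}(\mathbb{R})=\varinjlim_{q\in\mathbb{N}}\mathcal{K}^{\ast}_q(\mathbb{R})$; $\mathcal{K}'^{\ast}(\mathbb{R})$ is its dual. Under $(M.1)$ and $(M.3)'$, $\mathcal{D}^{\ast}(\mathbb{R})$ is continuously and densely included in $\mathcal{K}^{\ast}(\mathbb{R})$, so $\mathcal{K}'^{\ast}(\mathbb{R})$ is regarded as a subspace of $\mathcal{D}'^{\ast}(\mathbb{R})$. MAE. Let $\mathcal{X}$ be a locally convex space of smooth functions on $\mathbb{R}$ on which the dilation operators and the Dirac delta and all its derivatives act continuously. An element $f\in\mathcal{X}'$ satisfies the MAE in $\mathcal{X}'$ if there are $\mu_m\in\mathbb{C}$, $m\in\mathbb{N}$,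 such that for any $\varphi\in\mathcal{X}$ and $k\in\mathbb{N}$ $$\langle f(\lambda x),\varphi(x)\rangle=\sum_{m<k}\frac{\mu_m\varphi^{(m)}(0)}{m!\,\lambda^{m+1}}+O\!\left(\frac1{\lambda^{k+1}}\right),\qquad\lambda\to\infty,$$ where $\langle f(\lambda x),\varphi(x)\rangle=\lambda^{-1}\langle f(x),\varphi(x/\lambda)\rangle$. *)

(* Defs.v *)
(* MathComp-Analysis; complex numbers are [R[i]] from mathcomp-real-closed *)
From HB Require Import structures.
From mathcomp Require Import all_boot all_order all_algebra.
From mathcomp Require Import complex.
From mathcomp Require Import all_classical all_reals all_analysis.

Set Implicit Arguments.
Unset Strict Implicit.
Unset Printing Implicit Defensive.

Import Order.TTheory GRing.Theory Num.Theory.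
Import numFieldNormedType.Exports.

Local Open Scope complex_scope.
Local Open Scope classical_set_scope.
Local Open Scope ring_scope.

(* [Rcomplex R] is the library's alias of [R[i]] carrying the real-valued
   modulus and the real scalar multiplication; as a normed module over [R] it
   lets the library's derivatives and Landau symbols apply to complex-valued
   functions of a real variable. *)
Section Rcomplex_normedModType.
Context (R : rcfType).
Import ComplexField.Normc.

Lemma Rcomplex_normrZ (l : R) (z : Rcomplex R) : `|l *: z| = `|l| * `|z|.
Proof.
case: z => a b; rewrite /Num.norm /= /normc /=.
by rewrite !exprMn -mulrDr sqrtrM ?sqr_ge0// sqrtr_sqr.
Qed.

HB.instance Definition _ :=
  PseudoMetric.copy (Rcomplex R) (pseudoMetric_normed (Rcomplex R)).
HB.instance Definition _ := isPointed.Build (Rcomplex R) 0.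
HB.instance Definition _ :=
  NormedZmod_PseudoMetric_eq.Build R (Rcomplex R) erefl.
HB.instance Definition _ :=
  PseudoMetricNormedZmod_Lmodule_isNormedModule.Build R (Rcomplex R)
    Rcomplex_normrZ.

End Rcomplex_normedModType.

Section locally_convex.
Context (R : realType) (E : lmodType R[i]).

(* A topological vector space whose underlying space is a linear subspace of a
   fixed ambient space [E]. The topology is the translation-invariant one: the
   neighbourhoods of [phi] are the [phi + U] with [U] in [lcs_nbhs0]. Supersets
   (in [E]) of a neighbourhood of 0 are counted as neighbourhoods of 0; this
   makes inclusions of one such space into another the identity of [E]. *)
Record lcs := Lcs {
  lcs_carrier : set E ;
  lcs_nbhs0 : set_system E }.

Definition lcs_normed (A : set E) (N : E -> \bar R) : lcs :=
  let X := [set phi | A phi /\ (N phi < +oo)%E] in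
  Lcs X [set U | exists2 e : R,
    0 < e & [set phi | X phi /\ (N phi < e%:E)%E] `<=` U].

(* initial topology with respect to the inclusions into the [X i] *)
Definition lcs_projlim (I : Type) (D : set I) (X : I -> lcs) : lcs :=
  let Y := \bigcap_(i in D) lcs_carrier (X i) in
  Lcs Y [set U | exists J (V : I -> set E),
    [/\ finite_set J, J `<=` D,
        forall i, J i -> lcs_nbhs0 (X i) (V i)
      & Y `&` \bigcap_(i in J) V i `<=` U]].

Definition absolutely_convex (V : set E) : Prop :=
  forall (a b : R[i]) (phi psi : E), `|a| + `|b| <= 1 ->
    V phi -> V psi -> V (a *: phi + b *: psi).

(* finest locally convex topology making the inclusions of the [X i]
   continuous *)
Definition lcs_indlim (I : Type) (D : set I) (X : I -> lcs) : lcs :=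
  let Y := \bigcup_(i in D) lcs_carrier (X i) in
  Lcs Y [set U | exists V : set E,
    [/\ V `<=` Y, absolutely_convex V,
        forall i, D i -> lcs_nbhs0 (X i) V
      & V `<=` U]].

(* Functionals are total on [E]; only their values on the carrier matter. *)
Definition lcs_dual (X : lcs) (f : E -> R[i]) : Prop :=
  (forall (a : R[i]) phi psi, lcs_carrier X phi -> lcs_carrier X psi ->
     f (a *: phi + psi) = a * f phi + f psi) /\
  (forall phi, lcs_carrier X phi ->
     (f (phi + u) : Rcomplex R) @[u --> lcs_nbhs0 X]
       --> (f phi : Rcomplex R)).

(* Membership in the dual of [Y] of a functional on [X], for [X] continuously
   and densely included in [Y]: the dual of [Y] is identified with its image
   under restriction to [X]. *)
Definition in_dual_of (Y X : lcs) (f : E -> R[i]) : Prop :=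
  exists2 g, lcs_dual Y g & forall phi, lcs_carrier X phi -> f phi = g phi.

End locally_convex.

Section weight_sequences.
Context (R : realType).
Implicit Type M : nat -> R.

Definition weight_M1 M : Prop :=
  forall p : nat, (1 <= p)%N -> M p ^+ 2 <= M p.-1 * M p.+1.

Definition weight_M2' M : Prop :=
  exists A H : R, forall p : nat, M p.+1 <= A * H ^+ p * M p.

Definition weight_M3' M : Prop :=
  (\sum_(1 <= p <oo) (M p.-1 / M p)%:E < +oo)%E.

End weight_sequences.

Variant ultra_class := Beurling | Roumieu.

Canonical pinfty_filter_on (R : realType) : filter_on R :=
  FilterType (pinfty_nbhs R) _.

Section test_spaces.
Context (R : realType).
Local Notation C := R[i].
Implicit Types (phi : R -> C) (M : nat -> R).

Definition cderiven (m : nat) phi : R -> Rcomplex R :=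
  derive1n m (phi : R -> Rcomplex R).

Definition csmooth phi : Prop :=
  forall m x, derivable (cderiven m phi) x 1.

Definition supported_in (K : set R) phi : Prop :=
  closure [set x | phi x != 0] `<=` K.

Definition ultra_lim (c : ultra_class) (X : R -> lcs (R -> C)) : lcs (R -> C) :=
  match c with
  | Beurling => lcs_projlim [set l | 0 < l] X
  | Roumieu => lcs_indlim [set l | 0 < l] X
  end.

Definition D_norm M (l : R) (K : set R) phi : \bar R :=
  ereal_sup (range (fun m : nat =>
    ereal_sup [set (`|cderiven m phi x| / (l ^+ m * M m))%:E | x in K])).

Definition D_step M (l : R) (K : set R) : lcs (R -> C) :=
  lcs_normed [set phi | csmooth phi /\ supported_in K phi] (D_norm M l K).

Definition D_space (c : ultra_class) M : lcs (R -> C) :=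
  lcs_indlim (@compact R) (fun K => ultra_lim c (fun l => D_step M l K)).

Definition K_norm M (l : R) (q : nat) phi : \bar R :=
  ereal_sup (range (fun m : nat =>
    ereal_sup (range (fun x : R =>
      ((1 + `|x|) ^ (m%:Z - q%:Z) * `|cderiven m phi x|
         / (l ^+ m * M m))%:E)))).

Definition K_step M (l : R) (q : nat) : lcs (R -> C) :=
  lcs_normed csmooth (K_norm M l q).

Definition K_space (c : ultra_class) M : lcs (R -> C) :=
  lcs_indlim [set: nat] (fun q => ultra_lim c (fun l => K_step M l q)).

Definition dilated_pairing (f : (R -> C) -> C) (l : R) phi : C :=
  (l^-1)%:C * f (fun x => phi (x / l)).

Definition satisfies_MAE (X : lcs (R -> C)) (f : (R -> C) -> C) : Prop :=
  exists mu : nat -> C, forall phi (k : nat), lcs_carrier X phi ->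
    (fun l : R => dilated_pairing f l phi : Rcomplex R)
    = (fun l : R => (\sum_(m < k)
         mu m * cderiven m phi 0 / ((m`!)%:R * (l ^+ m.+1)%:C) : C)
         : Rcomplex R)
      +O_ (pinfty_nbhs R) (fun l : R => (l ^+ k.+1)^-1 : R^o).

End test_spaces.

(* Main.v *)
Require Import Defs.
From mathcomp Require Import all_boot all_order all_algebra.
From mathcomp Require Import complex ring lra.
From mathcomp Require Import all_classical all_reals all_analysis.

(* If g is in the dual of K, then mu_m = g(x^m), and lambda^k times the Taylor
   remainder of order k at 0 of phi(x/lambda) stays bounded in K_k as
   lambda -> oo.

   Conversely, let chi be a cutoff equal to 1 on [-1,1] and supported in [-2,2],
   and let eta(x) = chi(x) - chi(2x), which lives on an annulus.  The MAE gives
   f(phi(x/2^j)) = O(2^(-jk)) for every k and every phi supported in the annulus,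
   and the uniform boundedness principle makes this uniform on bounded sets.
   For psi in K_q the functions psi(2^j x) eta(x) have size 2^(jq), so taking
   k = q+1 the telescoping sum of the f(psi eta(x/2^j)) converges geometrically
   and defines the extension of f to psi. *)

Set Implicit Arguments.
Unset Strict Implicit.
Unset Printing Implicit Defensive.

Import Order.TTheory GRing.Theory Num.Theory.
Import numFieldNormedType.Exports.

Local Open Scope complex_scope.
Local Open Scope classical_set_scope.
Local Open Scope ring_scope.

(** * Differentiation of complex-valued functions *)

Section complex_calculus.
Context (R : realType).
Local Notation C := R[i].
Local Notation Re := complex.Re.
Local Notation Im := complex.Im.
Implicit Types (f g : R -> C) (u v : nat -> R -> C) (z w : C).

(** The weight [(1 + |x|)^(m - q)] ties the two directions together. Dilation by [s] multiplies an
    [m]-th derivative by [s^m]. Where [|x|] is bounded away from 0 the weight at [s x] is at least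
    of order [s^m] and pays for this factor; near 0 nothing does. Hence the decomposition into
    dyadic annuli: the rescaled pieces of an element of [K_q] obey bounds at one scale, independent
    of [j]. A function supported in the annulus has all its derivatives at 0 equal to zero, so the
    moments drop out of its expansion, whatever they are, and only rapid decay remains. A second
    obstacle is that the spaces are inductive limits, on which completeness cannot be used directly.
    Uniform boundedness is therefore proved on one step, with support and scale fixed, which is
    complete for countably many norms. Continuity on the limit is boundedness on each step. The
    cutoff is manufactured from an arbitrary nonzero test function. *)

Definition cabs z : R := `|(z : Rcomplex R)|.

Lemma cabsE z : cabs z = Num.sqrt (Re z ^+ 2 + Im z ^+ 2).
Proof. by case: z. Qed.

Lemma normC_cabs z : `|z| = (cabs z)%:C.
Proof. by rewrite normc_def cabsE. Qed.

Lemma cabs_ge0 z : 0 <= cabs z.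
Proof. exact: normr_ge0. Qed.

Lemma cabs0 : cabs 0 = 0.
Proof. exact: normr0. Qed.

Lemma cabs0_eq0 z : cabs z = 0 -> z = 0.
Proof. by move/eqP; rewrite normr_eq0 => /eqP. Qed.

Lemma cabsM z w : cabs (z * w) = cabs z * cabs w.
Proof. exact: ComplexField.Normc.normcM. Qed.

Lemma cabs_triangle z w : cabs (z + w) <= cabs z + cabs w.
Proof. exact: (@ler_normD _ (Rcomplex R)). Qed.

Lemma cabsN z : cabs (- z) = cabs z.
Proof. exact: (@normrN _ (Rcomplex R)). Qed.

Lemma cabs_triangleB z w : cabs (z - w) <= cabs z + cabs w.
Proof. by rewrite -(cabsN w); exact: cabs_triangle. Qed.

Lemma cabs_distC z w : cabs (z - w) = cabs (w - z).
Proof. by rewrite -cabsN opprB. Qed.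

Lemma cabs_via (w z t : C) : cabs (z - t) <= cabs (z - w) + cabs (w - t).
Proof. by rewrite (_ : z - t = (z - w) + (w - t)) ?cabs_triangle//; ring. Qed.

Lemma cabs_real (x : R) : cabs x%:C = `|x|.
Proof. by rewrite cabsE /= expr0n /= addr0 sqrtr_sqr. Qed.

Lemma cabs1 : cabs 1 = 1.
Proof. by rewrite (cabs_real 1) normr1. Qed.

Lemma cabsX z n : cabs (z ^+ n) = cabs z ^+ n.
Proof.
by elim: n => [|n IH]; rewrite ?expr0 ?cabs1// !exprS cabsM IH.
Qed.

Lemma cabs_Re z : `|Re z| <= cabs z.
Proof.
by rewrite cabsE -sqrtr_sqr ler_wsqrtr// lerDl sqr_ge0.
Qed.

Lemma cabs_Im z : `|Im z| <= cabs z.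
Proof.
by rewrite cabsE -sqrtr_sqr ler_wsqrtr// lerDr sqr_ge0.
Qed.

Lemma cabs_le_ReIm z : cabs z <= `|Re z| + `|Im z|.
Proof.
rewrite cabsE -[leRHS]ger0_norm ?addr_ge0// -sqrtr_sqr ler_wsqrtr//.
rewrite sqrrD !real_normK ?num_real// -addrA lerD2l lerDr.
by rewrite mulrn_wge0// mulr_ge0.
Qed.

Lemma cabs_conj z : cabs (z^*) = cabs z.
Proof. by rewrite !cabsE; case: z => a b /=; rewrite sqrrN. Qed.

(** Coordinatewise, so that the product rule and the mean value theorem come from real-valued
    functions; [is_derive_cder] ties it to the derivative behind [cderiven]. *)
Definition cder f (x : R) (d : C) : Prop :=
  is_derive x 1 (fun y => Re (f y)) (Re d) /\
  is_derive x 1 (fun y => Im (f y)) (Im d).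

Lemma Rcomplex_cvg (T : Type) (F : set_system T) (h : T -> Rcomplex R)
    (l : Rcomplex R) : Filter F ->
  h @ F --> l <-> (Re (h x) @[x --> F] --> (Re l : R^o)) /\
                  (Im (h x) @[x --> F] --> (Im l : R^o)).
Proof.
move=> FF; split.
- move=> hl; split; apply/cvgrPdist_lt => e e0;
    move/(@cvgrPdist_lt _ (Rcomplex R)): hl => /(_ e e0); apply: filterS => x;
    apply: le_lt_trans.
  + by have := cabs_Re (l - h x); rewrite raddfB.
  + by have := cabs_Im (l - h x); rewrite raddfB.
- move=> [h1 h2]; apply/(@cvgrPdist_lt _ (Rcomplex R)) => e e0.
  have e20 : 0 < e / 2 by rewrite divr_gt0.
  move/cvgrPdist_lt: h1 => /(_ _ e20) h1; move/cvgrPdist_lt: h2 => /(_ _ e20).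
  move: h1; apply: filterS2 => x; rewrite -!raddfB => a b.
  rewrite (splitr e); apply: le_lt_trans (ltrD a b).
  exact: cabs_le_ReIm.
Qed.

Lemma is_derive_cder f (x : R) (d : C) :
  is_derive x (1 : R) (f : R -> Rcomplex R) (d : Rcomplex R) <-> cder f x d.
Proof.
have K (V : normedModType R) (h : R -> V) (l : V) : is_derive x (1 : R) h l <->
    (t^-1 *: (h (t *: 1 + x) - h x)) @[t --> 0^'] --> l.
  split=> [[dh <-]|hl]; first exact: dh.
  split; first by apply/cvg_ex; exists l.
  exact: cvg_lim.
rewrite /cder 3!K Rcomplex_cvg.
by split => -[a b]; split; [move: a|move: b|move: a|move: b];
  apply: cvg_trans; apply: near_eq_cvg; near=> t => /=;
  case: (f _) => ? ?; case: (f _) => ? ? /=.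
Unshelve. all: by end_near. Qed.

End complex_calculus.

Section cder_rules.
Context (R : realType).
Local Notation C := R[i].
Local Notation Re := complex.Re.
Local Notation Im := complex.Im.
Implicit Types (f g : R -> C) (u v : nat -> R -> C) (z w d e : C) (x : R).

Lemma is_derive_ext_val (h k : R -> R) x (a b : R) :
  h =1 k -> a = b -> is_derive x 1 h a -> is_derive x 1 k b.
Proof. by move=> /funext -> ->. Qed.

Lemma cder_ext f g x d e : f =1 g -> d = e -> cder f x d -> cder g x e.
Proof. by move=> /funext -> ->. Qed.

Lemma cderD f g x d e : cder f x d -> cder g x e ->
  cder (fun y => f y + g y) x (d + e).
Proof.
move=> [a b] [a' b']; split.
- apply: (is_derive_ext_val _ _ (is_deriveD a a')) => [y|]; by rewrite raddfD.
- apply: (is_derive_ext_val _ _ (is_deriveD b b')) => [y|]; by rewrite raddfD.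
Qed.

Lemma cderM f g x d e : cder f x d -> cder g x e ->
  cder (fun y => f y * g y) x (d * g x + f x * e).
Proof.
move=> [a b] [a' b']; split.
- apply: (is_derive_ext_val _ _
    (is_deriveB (is_deriveM a a') (is_deriveM b b'))) => [y|] /=.
    by rewrite !fctE; case: (f y) (g y) => ? ? [? ?].
  rewrite /GRing.scale /=.
  by case: (f x) (g x) d e {a b a' b'} => ? ? [? ?] [? ?] [? ?] /=; ring.
- apply: (is_derive_ext_val _ _
    (is_deriveD (is_deriveM a b') (is_deriveM b a'))) => [y|] /=.
    rewrite !fctE.
    by case: (f y) (g y) => ? ? [? ?] /=; ring.
  rewrite /GRing.scale /=.
  by case: (f x) (g x) d e {a b a' b'} => ? ? [? ?] [? ?] [? ?] /=; ring.
Qed.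

Lemma cder_cst z x : cder (fun=> z) x 0.
Proof. by split; exact: is_derive_cst. Qed.

Lemma cderZ z f x d : cder f x d -> cder (fun y => z * f y) x (z * d).
Proof.
move=> fd; apply: cder_ext (cderM (cder_cst z x) fd) => //=.
by rewrite mul0r add0r.
Qed.

Lemma cder_real (F : R -> R) x (d : R) :
  is_derive x 1 F d -> cder (fun y => (F y)%:C) x d%:C.
Proof. by move=> Fd; split => //=; exact: is_derive_cst. Qed.

Lemma cder_conj f x d : cder f x d -> cder (fun y => (f y)^*) x d^*.
Proof.
move=> [a b]; split.
- by apply: is_derive_ext_val a => [y|]; [case: (f y)|case: (d)].
- apply: is_derive_ext_val (is_deriveN b) => [y|].
    by rewrite fctE; case: (f y).
  by case: (d).
Qed.

Lemma is_derive_affine (a b x : R) : is_derive x 1 (fun y => a * y + b) a.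
Proof.
have := is_deriveD (is_deriveZ a (is_derive_id x (1 : R))) (is_derive_cst b x 1).
by apply: is_derive_ext_val => //; rewrite addr0 /GRing.scale /= mulr1.
Qed.

Lemma cder_affine f (a b x : R) d : cder f (a * x + b) d ->
  cder (fun y => f (a * y + b)) x (a%:C * d).
Proof.
move=> [fa fb]; have K := is_derive_affine a b x; split.
- apply: is_derive_ext_val (@is_derive1_comp _ _ (fun y => a * y + b) _ _ _ fa K) => //.
  by case: (d) => ? ? /=; ring.
- apply: is_derive_ext_val (@is_derive1_comp _ _ (fun y => a * y + b) _ _ _ fb K) => //.
  by case: (d) => ? ? /=; ring.
Qed.

Lemma is_derive_continuous (h : R -> R) x (a : R) :
  is_derive x 1 h a -> {for x, continuous h}.
Proof.
by move=> [H _]; apply/differentiable_continuous/derivable1_diffP.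
Qed.

Lemma is_derive_dist_le (h dh : R -> R) (x0 x B : R) :
  (forall y : R, is_derive y 1 h (dh y)) ->
  (forall y, `|y - x0| <= `|x - x0| -> `|dh y| <= B) ->
  `|h x - h x0| <= B * `|x - x0|.
Proof.
move=> hd hB.
have ct a b : {within `[a, b], continuous h}.
  by apply: continuous_subspaceT => y; exact: is_derive_continuous (hd y).
have [xx|xx] := leP x x0.
- have [y] := MVT_segment xx (fun y _ => hd y) (ct _ _).
  rewrite in_itv /= => /andP[y1 y2] E; rewrite distrC E normrM (distrC x0).
  by rewrite ler_wpM2r// hB// !ler0_norm ?subr_le0//; lra.
- have [y] := MVT_segment (ltW xx) (fun y _ => hd y) (ct _ _).
  rewrite in_itv /= => /andP[y1 y2] E; rewrite E normrM.
  by rewrite ler_wpM2r// hB// !ger0_norm ?subr_ge0//; lra.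
Qed.

(** The mean value theorem fails for complex-valued functions; applying it to the real and imaginary
    parts separately costs the factor 2. *)
Lemma cder_dist_le f g (x0 x B : R) :
  (forall y, cder f y (g y)) ->
  (forall y, `|y - x0| <= `|x - x0| -> cabs (g y) <= B) ->
  cabs (f x - f x0) <= 2 * B * `|x - x0|.
Proof.
move=> fg gB; apply: le_trans (cabs_le_ReIm _) _.
rewrite (_ : 2 * B * _ = B * `|x - x0| + B * `|x - x0|); last by ring.
rewrite !raddfB; apply: lerD.
- apply: (is_derive_dist_le (fun y => (fg y).1)) => y /gB.
  exact: le_trans (cabs_Re _).
- apply: (is_derive_dist_le (fun y => (fg y).2)) => y /gB.
  exact: le_trans (cabs_Im _).
Qed.

Lemma is_derive_quadratic (h : R -> R) (x d B : R) :
  (forall t, `|h (x + t) - h x - t * d| <= B * t ^+ 2) -> is_derive x 1 h d.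
Proof.
move=> H.
have K : (t^-1 *: (h (t *: (1 : R) + x) - h x)) @[t --> 0^'] --> (d : R^o).
  apply/cvgrPdist_le => e e0; near=> t.
  have t0 : t != 0 by near: t; exact: nbhs_dnbhs_neq.
  rewrite /GRing.scale /= mulr1 (addrC t) distrC.
  rewrite (_ : _ - d = t^-1 * (h (x + t) - h x - t * d)); last by field.
  rewrite normrM normrV ?unitfE// ler_pdivrMl ?normr_gt0//.
  apply: le_trans (H t) _; rewrite -real_normK ?num_real// expr2 mulrA mulrC.
  rewrite ler_wpM2l//.
  apply: le_trans (_ : `|B| * `|t| <= _); first by rewrite ler_wpM2r// ler_norm.
  have B1 : 0 < `|B| + 1 by rewrite ltr_wpDl.
  apply: le_trans (_ : (`|B| + 1) * `|t| <= _); first by rewrite ler_wpM2r// lerDl.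
  rewrite -ler_pdivlMl// mulrC.
  near: t; apply: dnbhs0_le; exact: divr_gt0.
split; first by apply/cvg_ex; exists d.
exact: cvg_lim.
Unshelve. all: by end_near. Qed.

(** An inequality with a constant independent of [t] survives pointwise limits of [f]; this is how
    limits are differentiated in [inD_complete]. *)
Lemma cder_quadratic f x d (B : R) :
  (forall t : R, cabs (f (x + t) - f x - t%:C * d) <= B * t ^+ 2) -> cder f x d.
Proof.
move=> H; split; apply: (@is_derive_quadratic _ _ _ B) => t;
  apply: le_trans (H t).
- apply: le_trans (cabs_Re _); rewrite !raddfB /=.
  by case: d {H} => ? ? /=; rewrite mul0r subr0.
- apply: le_trans (cabs_Im _); rewrite !raddfB /=.
  by case: d {H} => ? ? /=; rewrite mul0r addr0.
Qed.

Lemma cder_near0 f x d : (\forall y \near x, f y = 0) -> cder f x d -> d = 0.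
Proof.
move=> f0 [[_ a] [_ b]].
have K (h : R -> R) (z : R) : (\forall y \near x, h y = 0) ->
    'D_1 h x = z -> z = 0.
  by move=> h0 <-; rewrite (@near_eq_derive _ _ _ h (cst 0)) ?derive_cst.
have d1 : Re d = 0 by apply: K a; apply: filterS f0 => y ->.
have d2 : Im d = 0 by apply: K b; apply: filterS f0 => y ->.
by case: d d1 d2 {a b} => ? ? /= -> ->.
Qed.

(** A function bundled with all its derivatives: giving the sequence in closed form and checking one
    step replaces computing iterated derivatives. *)
Definition tower u := forall m x, cder (u m) x (u m.+1 x).

Lemma csmooth_tower f : csmooth f -> tower (fun m => cderiven m f).
Proof.
move=> sf m x; apply/is_derive_cder.
by have /derivableP := sf m x; rewrite /cderiven /= derive1E.
Qed.

Lemma tower_cderiven u m : tower u -> cderiven m (u 0%N) = u m.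
Proof.
move=> tu; elim: m => [//|m IH]; apply/funext => x.
rewrite -[LHS]/(derive1 (cderiven m (u 0%N)) x) IH derive1E.
by have /is_derive_cder [] := tu m x.
Qed.

Lemma tower_csmooth u : tower u -> csmooth (u 0%N).
Proof.
move=> tu m x; rewrite tower_cderiven//.
by have /is_derive_cder [] := tu m x.
Qed.

End cder_rules.

(** * Geometric convergence and a Taylor estimate *)

Section limits.
Context (R : realType).
Local Notation C := R[i].
Local Notation Re := complex.Re.
Local Notation Im := complex.Im.

Lemma halving_le (r : nat -> R) (k : nat) :
  (forall k, r k.+1 <= r k / 2) -> r k <= r 0%N / 2 ^+ k.
Proof.
move=> H; elim: k => [|k IH]; first by rewrite expr0 divr1.
apply: le_trans (H k) _; rewrite exprSr invfM mulrA.
by rewrite ler_wpM2r.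
Qed.

Lemma le_add_halving (a b B : R) :
  (forall k : nat, a <= b + B / 2 ^+ k) -> a <= b.
Proof.
move=> H; rewrite leNgt; apply/negP => ba.
have d0 : 0 < a - b by rewrite subr_gt0.
have [k Bk] : exists k : nat, B / (a - b) < 2 ^+ k.
  exists (Num.truncn (B / (a - b))).+1.
  apply: lt_trans (truncnS_gt _) _; rewrite -natrX ltr_nat.
  exact: ltn_expl.
have := H k; rewrite leNgt => /negP; apply.
rewrite -ltrBrDl ltr_pdivrMr ?exprn_gt0// mulrC -ltr_pdivrMr//.
Qed.

(** The intervals of centre [z k] and radius [2 * r k] are nested because [r] at least halves, so
    the supremum of their left ends lies in all of them. *)
Lemma halving_cauchyR (z r : nat -> R) :
  (forall k, `|z k.+1 - z k| <= r k) -> (forall k, r k.+1 <= r k / 2) ->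
  exists w, forall k, `|w - z k| <= 2 * r k.
Proof.
move=> zr rr.
have r0 k : 0 <= r k by exact: le_trans (zr k).
have lo m n : (m <= n)%N -> z m - 2 * r m <= z n - 2 * r n.
  elim: n => [|n IH]; first by rewrite leqn0 => /eqP ->.
  rewrite leq_eqVlt => /predU1P[->//|/IH]; have := rr n; have := zr n.
  by rewrite ler_norml => /andP[]; lra.
have hi m n : (m <= n)%N -> z n + 2 * r n <= z m + 2 * r m.
  elim: n => [|n IH]; first by rewrite leqn0 => /eqP ->.
  rewrite leq_eqVlt => /predU1P[->//|/IH]; have := rr n; have := zr n.
  by rewrite ler_norml => /andP[]; lra.
have lohi m n : z m - 2 * r m <= z n + 2 * r n.
  have [mn|/ltnW mn] := leqP m n.
    by have := lo _ _ mn; have := r0 n; lra.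
  by have := hi _ _ mn; have := r0 m; lra.
pose A := range (fun k => z k - 2 * r k).
have supA : has_sup A.
  split; first by exists (z 0%N - 2 * r 0%N); exists 0%N.
  by exists (z 0%N + 2 * r 0%N) => _ [k _ <-].
exists (sup A) => k; rewrite ler_norml; apply/andP; split.
  have : z k - 2 * r k <= sup A by apply: ub_le_sup => //; [case: supA|exists k].
  by lra.
have : sup A <= z k + 2 * r k.
  by apply: ge_sup; [case: supA|move=> _ [m _ <-]].
by lra.
Qed.

Lemma halving_cauchy (z : nat -> C) (r : nat -> R) :
  (forall k, cabs (z k.+1 - z k) <= r k) -> (forall k, r k.+1 <= r k / 2) ->
  exists w, forall k, cabs (w - z k) <= 4 * r k.
Proof.
move=> zr rr.
have [k|w1 H1] := halving_cauchyR (z := fun k => Re (z k)) _ rr.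
  by apply: le_trans (zr k); rewrite -raddfB; exact: cabs_Re.
have [k|w2 H2] := halving_cauchyR (z := fun k => Im (z k)) _ rr.
  by apply: le_trans (zr k); rewrite -raddfB; exact: cabs_Im.
exists (w1 +i* w2) => k; apply: le_trans (cabs_le_ReIm _) _.
rewrite !raddfB /=; have := H1 k; have := H2 k; lra.
Qed.

(** [cder_dist_le] is applied to [u m.+1] and then to [u m] minus its tangent at [x]; each use
    contributes a factor 2. *)
Lemma tower_taylor1 (u : nat -> R -> C) m (x t B : R) :
  tower u -> (forall y, cabs (u m.+2 y) <= B) ->
  cabs (u m (x + t) - u m x - t%:C * u m.+1 x) <= 4 * B * t ^+ 2.
Proof.
move=> tu uB.
have B0 : 0 <= B by apply: le_trans (uB 0); exact: cabs_ge0.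
pose f y := u m y - (y - x)%:C * u m.+1 x.
have fd y : cder f y (u m.+1 y - u m.+1 x).
  have k := cderM (cder_real (is_derive_affine 1 (- x) y))
                  (cder_cst (- u m.+1 x) y).
  apply: cder_ext (cderD (tu m y) k) => [s|] /=.
    by rewrite mul1r /f mulrN.
  by rewrite mulr0 addr0 mul1r.
have := cder_dist_le (x0 := x) (x := x + t) (B := 2 * B * `|t|) fd.
rewrite (addrC x t) addrK => H.
rewrite (_ : _ - _ - _ = f (t + x) - f x); last first.
  by rewrite /f addrK subrr mul0r subr0 addrAC.
apply: le_trans (H _) _ => [y yt|].
  apply: le_trans (cder_dist_le (B := B) (fun s => tu m.+1 s) (fun s _ => uB s)) _.
  by rewrite ler_wpM2l// mulr_ge0.
rewrite -[t ^+ 2]real_normK ?num_real// expr2.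
rewrite le_eqVlt; apply/orP; left; apply/eqP; ring.
Qed.

End limits.

(** * Products and the Leibniz estimate *)

Section products.
Context (R : realType).
Local Notation C := R[i].
Implicit Types (u v : nat -> R -> C) (M : nat -> R).

(* The [m]-th derivative of [u a * v b]; this recursion gives the Leibniz
   estimate without binomial sums. *)
Fixpoint mul_tower u v (m a b : nat) : R -> C :=
  if m is m'.+1 then
    fun x => mul_tower u v m' a.+1 b x + mul_tower u v m' a b.+1 x
  else fun x => u a x * v b x.

Lemma tower_mul u v a b : tower u -> tower v ->
  tower (fun m => mul_tower u v m a b).
Proof.
move=> tu tv m; elim: m a b => [|m IH] a b x /=.
  exact: cderM (tu a x) (tv b x).
exact: cderD (IH _ _ x) (IH _ _ x).
Qed.

Lemma mul_tower0 u v m a b x : (forall i, v i x = 0) ->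
  mul_tower u v m a b x = 0.
Proof.
move=> v0; elim: m a b => [|m IH] a b /=; first by rewrite v0 mulr0.
by rewrite !IH addr0.
Qed.

Lemma weight_ratio M (M_gt0 : forall p, 0 < M p) : weight_M1 M ->
  forall a b, (a <= b)%N -> M a.+1 * M b <= M a * M b.+1.
Proof.
move=> M1 a b; elim: b => [|b IH]; first by rewrite leqn0 => /eqP ->; rewrite mulrC.
rewrite leq_eqVlt => /predU1P[->|]; first by rewrite mulrC.
rewrite ltnS => /IH H; have K := M1 b.+1 isT; rewrite /= expr2 in K.
rewrite -(ler_pM2r (M_gt0 b)) mulrAC.
apply: le_trans (_ : M a * M b.+1 * M b.+1 <= _); first by rewrite ler_wpM2r// ltW.
by rewrite -!mulrA ler_wpM2l ?(ltW (M_gt0 a))// (mulrC (M b.+2)).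
Qed.

(** Moving one unit from the smaller index to the larger cannot decrease the product, by
    [weight_ratio]; repeat until the smaller index is 0. *)
Lemma weight_mul_le M (M_gt0 : forall p, 0 < M p) (M1 : weight_M1 M) a b :
  M a * M b <= M 0%N * M (a + b)%N.
Proof.
wlog ab : a b / (a <= b)%N => [H|].
  have [/H//|/ltnW /H] := leqP a b; by rewrite mulrC addnC.
elim: a b ab => [//|a IH] b ab; rewrite addSnnS.
apply: le_trans (IH b.+1 _); last by rewrite (leq_trans (ltnW ab)).
by apply: weight_ratio => //; exact: ltnW.
Qed.

(** Each differentiation yields one copy of the bound with an extra factor [l] and one with an extra
    [h], so the scales of the factors add. The starting orders [a] and [b] are general for the sake
    of the induction; the applications take both to be 0. *)
Lemma mul_tower_le M u v (A B l h x : R) m a b :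
  (forall p, 0 < M p) -> weight_M1 M -> 0 < l -> 0 < h ->
  (forall i, cabs (u i x) <= A * (l ^+ i * M i)) ->
  (forall i, cabs (v i x) <= B * (h ^+ i * M i)) ->
  cabs (mul_tower u v m a b x) <=
    A * B * M 0%N * l ^+ a * h ^+ b * ((l + h) ^+ m * M (m + a + b)%N).
Proof.
move=> M_gt0 M1 l0 h0 uA vB.
have A0 : 0 <= A.
  rewrite -(pmulr_lge0 A (_ : 0 < l ^+ 0 * M 0%N)) ?mulr_gt0//.
  exact: le_trans (cabs_ge0 _) (uA 0%N).
have B0 : 0 <= B.
  rewrite -(pmulr_lge0 B (_ : 0 < h ^+ 0 * M 0%N)) ?mulr_gt0//.
  exact: le_trans (cabs_ge0 _) (vB 0%N).
elim: m a b => [|m IH] a b /=.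
  rewrite cabsM expr0 mul1r add0n.
  apply: le_trans (ler_pM (cabs_ge0 _) (cabs_ge0 _) (uA a) (vB b)) _.
  have := weight_mul_le M_gt0 M1 a b.
  have : 0 <= A * B * l ^+ a * h ^+ b by rewrite !mulr_ge0// exprn_ge0 ?ltW.
  move: (M a) (M 0%N) (M b) (M (a + b)%N) (l ^+ a) (h ^+ b).
  move=> x1 x2 x3 x4 x5 x6 /ler_wpM2l K /K {}K.
  rewrite [leLHS](_ : _ = A * B * x5 * x6 * (x1 * x3)); last by ring.
  by apply: le_trans K _; rewrite le_eqVlt; apply/orP; left; apply/eqP; ring.
apply: le_trans (cabs_triangle _ _) _.
apply: le_trans (lerD (IH a.+1 b) (IH a b.+1)) _.
have -> : (m + a.+1 + b = m.+1 + a + b)%N by rewrite addnS !addSn.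
have -> : (m + a + b.+1 = m.+1 + a + b)%N by rewrite addnS !addSn.
rewrite !exprS; move: (M _) (M 0%N) (l ^+ a) (h ^+ b) (_ ^+ m) => x1 x2 x3 x4 x5.
rewrite le_eqVlt; apply/orP; left; apply/eqP; ring.
Qed.

End products.

(** * Uniform boundedness on test functions *)

Lemma eq0_lin0 (R : realType) (E : lmodType R[i]) (f : E -> R[i]) :
  f (1 *: 0 + 0) = 1 * f 0 + f 0 -> f 0 = 0.
Proof.
rewrite scaler0 addr0 mul1r => /eqP.
by rewrite -subr_eq0 opprD addrA subrr sub0r oppr_eq0 => /eqP.
Qed.

Section test_functions.
Context (R : realType).
Local Notation C := R[i].
Implicit Types (phi psi : R -> C) (M : nat -> R) (c : ultra_class) (K : set R).

Lemma csmooth_lin (a : C) phi psi : csmooth phi -> csmooth psi ->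
  csmooth (a *: phi + psi) /\ forall m x,
  cderiven m (a *: phi + psi) x = a * cderiven m phi x + cderiven m psi x :> C.
Proof.
move=> /csmooth_tower tp /csmooth_tower tq.
have tu : tower (fun m x => (a * cderiven m phi x + cderiven m psi x : C)).
  by move=> m x; exact: cderD (cderZ a (tp m x)) (tq m x).
by split; [exact: tower_csmooth tu|move=> m x; rewrite (tower_cderiven m tu)].
Qed.

Lemma cderiven_off K phi m x : csmooth phi -> closed K ->
  (forall y, ~ K y -> phi y = 0) -> ~ K x -> cderiven m phi x = 0 :> C.
Proof.
move=> /csmooth_tower tp cK p0; elim: m x => [|m IH] x Kx; first exact: p0.
apply: (cder_near0 _ (tp m x)).
have : nbhs x (~` K) by apply: open_nbhs_nbhs; split => //; exact: closed_openC.
by apply: filterS => y; exact: IH.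
Qed.

Definition bdd M (l b : R) phi : Prop :=
  forall m x, cabs (cderiven m phi x) <= b * (l ^+ m * M m).

Lemma bdd_lin M l b b' (a : C) phi psi : csmooth phi -> csmooth psi ->
  bdd M l b phi -> bdd M l b' psi ->
  bdd M l (cabs a * b + b') (a *: phi + psi).
Proof.
move=> sp sq bp bq m x; have [_ ->] := csmooth_lin a sp sq.
apply: le_trans (cabs_triangle _ _) _; rewrite mulrDl cabsM -mulrA.
by rewrite lerD// ler_wpM2l ?cabs_ge0.
Qed.

(* Beurling and Roumieu spaces are treated uniformly: for [c = Roumieu] the
   sequence [lev c a] is the single scale [a], and the spaces are unions over
   [a]; for [c = Beurling] it tends to 0, so that the bounds [bdd] at all
   [lev c a n] describe the projective limit whatever [a]. *)
Definition lev c (a : R) (n : nat) : R :=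
  a * (if c is Beurling then n.+1%:R^-1 else 1).

Lemma lev_gt0 c a n : 0 < a -> 0 < lev c a n.
Proof. by move=> a0; rewrite mulr_gt0//; case: c. Qed.

Lemma lev_le c a n k : 0 < a -> (n <= k)%N -> lev c a k <= lev c a n.
Proof.
move=> a0 nk; rewrite ler_wpM2l ?(ltW a0)//; case: c => //.
by rewrite lef_pV2 ?posrE// ler_nat.
Qed.

Lemma levD c a b n : lev c (a + b) n = lev c a n + lev c b n.
Proof. exact: mulrDl. Qed.

Lemma levM c a b n : lev c (a * b) n = a * lev c b n.
Proof. by rewrite /lev mulrA. Qed.

Lemma bdd_le M l l' b b' phi : (forall p, 0 < M p) -> 0 < l -> l <= l' ->
  b <= b' -> bdd M l b phi -> bdd M l' b' phi.
Proof.
move=> M_gt0 l0 ll bb H m x; apply: le_trans (H m x) _.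
have b0 : 0 <= b.
  rewrite -(pmulr_lge0 b (_ : 0 < l ^+ 0 * M 0%N)) ?mulr_gt0//.
  exact: le_trans (cabs_ge0 _) (H 0%N x).
apply: ler_pM => //; first by rewrite mulr_ge0 ?exprn_ge0 ?ltW.
apply: ler_wpM2r; first exact: ltW.
by rewrite lerXn2r ?nnegrE// ltW// (lt_le_trans l0).
Qed.

(** With [a] and [K] fixed, the best bounds at the levels [lev c a n] form a countable family of
    norms for which this space is complete: a Fréchet space, and a Banach space in the Roumieu
    case. *)
Definition inD M c (a : R) K phi : Prop :=
  [/\ csmooth phi, forall x, ~ K x -> phi x = 0 &
      forall n, exists b, bdd M (lev c a n) b phi].

Lemma inD_lin M c a K (z : C) phi psi :
  inD M c a K phi -> inD M c a K psi -> inD M c a K (z *: phi + psi).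
Proof.
move=> [sp p0 bp] [sq q0 bq]; split; first by case: (csmooth_lin z sp sq).
- by move=> x Kx; rewrite -[LHS]/(z * phi x + psi x) p0// q0// mulr0 addr0.
- move=> n; have [b Hb] := bp n; have [b' Hb'] := bq n.
  by exists (cabs z * b + b'); exact: bdd_lin.
Qed.

Lemma cderiven0 m x : cderiven m (0 : R -> C) x = 0 :> C.
Proof.
have t0 : tower (fun _ _ => 0 : C) by move=> k y; exact: cder_cst.
by rewrite (tower_cderiven m t0).
Qed.

Lemma bdd0 M l b : (forall p, 0 < M p) -> 0 < l -> 0 <= b -> bdd M l b 0.
Proof.
by move=> M_gt0 l0 b0 m x; rewrite cderiven0 cabs0 !mulr_ge0 ?exprn_ge0// ltW.
Qed.

Lemma inD0 M c a K : (forall p, 0 < M p) -> 0 < a -> inD M c a K 0.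
Proof.
move=> M_gt0 a0; split => //.
- have t0 : tower (fun _ _ => 0 : C) by move=> k y; exact: cder_cst.
  exact: tower_csmooth t0.
- by move=> n; exists 0; apply: bdd0 => //; exact: lev_gt0.
Qed.

Lemma inD_scale M c a K (z : C) phi : (forall p, 0 < M p) -> 0 < a ->
  inD M c a K phi -> inD M c a K (z *: phi).
Proof.
by move=> M_gt0 a0 Hp; rewrite -[_ *: _]addr0; apply: inD_lin => //; exact: inD0.
Qed.

Lemma bdd_scale M l b (z : C) phi : (forall p, 0 < M p) -> 0 < l ->
  csmooth phi -> bdd M l b phi -> bdd M l (cabs z * b) (z *: phi).
Proof.
move=> M_gt0 l0 sp bp; rewrite -[_ *: _]addr0 -[_ * b]addr0.
apply: bdd_lin => //; last exact: bdd0.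
by have [] := inD0 Beurling setT M_gt0 l0.
Qed.

(** Completeness in the form required by a gliding hump: the [k]-th increment is measured in the
    norm of index [n k], which gets stronger with [k]. Every order of derivative converges
    uniformly, and the limits form a tower because a Taylor inequality passes to the limit. *)
Lemma inD_complete M c a K (s : nat -> R -> C) (n : nat -> nat) (d : nat -> R) :
  (forall p, 0 < M p) -> 0 < a -> (forall k, inD M c a K (s k)) ->
  (forall k, (n k <= n k.+1)%N) -> (forall k, (k <= n k)%N) ->
  (forall k, d k.+1 <= d k / 2) ->
  (forall k, bdd M (lev c a (n k)) (d k) (s k.+1 - s k)) ->
  exists2 y, inD M c a K y &
    forall k, bdd M (lev c a (n k)) (4 * d k) (y - s k).
Proof.
move=> M_gt0 a0 sD nn kn dd sb.
have subS phi psi : csmooth phi -> csmooth psi -> csmooth (phi - psi) /\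
    forall m x, cderiven m (phi - psi) x = cderiven m phi x - cderiven m psi x :> C.
  move=> sp sq; have := csmooth_lin (-1) sq sp; rewrite scaleN1r addrC => -[? H].
  by split=> // m x; rewrite H mulN1r addrC.
have d0 k : 0 <= d k.
  rewrite -(pmulr_lge0 _ (_ : 0 < lev c a (n k) ^+ 0 * M 0%N)) ?mulr_gt0//.
  exact: le_trans (cabs_ge0 _) (sb k 0%N 0).
have ss k : csmooth (s k) by case: (sD k).
pose rho m k := d k * (lev c a (n k) ^+ m * M m).
have rho0 m k : 0 <= rho m k.
  by rewrite !mulr_ge0// ?exprn_ge0// ltW// lev_gt0.
have rhod m k : rho m k.+1 <= rho m k / 2.
  rewrite /rho mulrAC; apply: ler_pM => //.
    by rewrite mulr_ge0 ?exprn_ge0 ?ltW ?lev_gt0.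
  apply: ler_wpM2r; first exact: ltW.
  by rewrite lerXn2r ?nnegrE ?(ltW (lev_gt0 _ _ a0))// lev_le.
have [v Hv] : exists v : nat -> R -> C, forall m x k,
    cabs (v m x - cderiven m (s k) x) <= 4 * rho m k.
  suff H m x : exists w : C, forall k, cabs (w - cderiven m (s k) x) <= 4 * rho m k.
    exists (fun m x => projT1 (cid (H m x))) => m x; exact: projT2 (cid (H m x)).
  apply: halving_cauchy => // k.
  by have [_ <-] := subS _ _ (ss k.+1) (ss k); exact: sb.
have vlim (z : R) m (e : R) : 0 <= z ->
    (forall k, e <= z + 4 * rho m k) -> e <= z.
  move=> z0 H; apply: (@le_add_halving _ _ _ (4 * rho m 0%N)) => k.
  apply: le_trans (H k) _; rewrite lerD2l -mulrA ler_wpM2l//.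
  exact: halving_le.
have tv : tower v.
  move=> m x.
  (* A bound on the derivatives of order [m + 2] of all the [s k] at once makes the quadratic Taylor
     error uniform in [k]. *)
  have [b Hb] : exists b, forall k y, cabs (cderiven m.+2 (s k) y) <= b.
    have [_ _ /(_ 0%N)[b Hb]] := sD 0%N.
    exists (b * (lev c a 0 ^+ m.+2 * M m.+2) + 4 * rho m.+2 0%N + 4 * rho m.+2 0%N).
    move=> k y.
    rewrite -[X in cabs X](subrK (v m.+2 y)) -[X in _ + X](subrK (cderiven m.+2 (s 0%N) y)).
    rewrite addrC.
    apply: le_trans (cabs_triangle _ _) _; apply: lerD; last first.
      rewrite cabs_distC; apply: le_trans (Hv _ _ _) _; rewrite ler_wpM2l//.
      apply: le_trans (halving_le _ (rhod _)) _.
      by rewrite ler_pdivrMr ?exprn_gt0// ler_peMr// exprn_ege1// ler1n.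
    rewrite addrC; apply: le_trans (cabs_triangle _ _) _.
    by rewrite lerD.
  apply: (@cder_quadratic _ _ _ _ (4 * b)) => t.
  apply: (@le_add_halving _ _ _
    (4 * rho m 0%N + 4 * rho m 0%N + `|t| * (4 * rho m.+1 0%N))) => k.
  have rk p : 4 * rho p k <= 4 * rho p 0%N / 2 ^+ k.
    by rewrite -mulrA ler_wpM2l//; exact: halving_le.
  pose u := fun m => cderiven m (s k) : R -> C.
  have tu : tower u by exact: csmooth_tower.
  have := tower_taylor1 x t tu (Hb k) => H.
  rewrite (_ : _ - _ = (u m (x + t) - u m x - t%:C * u m.+1 x) +
    ((v m (x + t) - u m (x + t)) - (v m x - u m x) - t%:C * (v m.+1 x - u m.+1 x)));
    last by ring.
  apply: le_trans (cabs_triangle _ _) _; apply: lerD => //.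
  rewrite mulrDl [(4 * _ + _) / _]mulrDl.
  apply: le_trans (cabs_triangleB _ _) _; apply: lerD.
    apply: le_trans (cabs_triangleB _ _) _.
    by apply: lerD; exact: (le_trans (Hv m _ k) (rk m)).
  rewrite cabsM cabs_real -mulrA ler_wpM2l//.
  exact: (le_trans (Hv m.+1 _ k) (rk m.+1)).
have dv m : cderiven m (v 0%N) = v m by exact: tower_cderiven.
have sv : csmooth (v 0%N) by exact: tower_csmooth.
have bv k : bdd M (lev c a (n k)) (4 * d k) (v 0%N - s k).
  move=> m x; have [_ ->] := subS _ _ sv (ss k).
  by rewrite dv -mulrA; exact: Hv.
exists (v 0%N) => //; split=> //.
- move=> x Kx; apply: cabs0_eq0; apply/eqP; rewrite eq_le cabs_ge0 andbT.
  apply: (vlim _ 0%N) => // k; rewrite add0r.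
  have [_ p0 _] := sD k.
  by have := Hv 0%N x k; rewrite /cderiven /= p0// subr0.
(* Since [k <= n k], closeness in the norm of index [n k] gives closeness in that of index [k], so
   every norm of the limit is finite. *)
- move=> k; have [_ _ /(_ k)[b Hb]] := sD k.
  have Hk : bdd M (lev c a k) (4 * d k) (v 0%N - s k).
    apply: bdd_le (bv k) => //; first exact: lev_gt0.
    exact: lev_le.
  exists (cabs 1 * (4 * d k) + b).
  rewrite -[v 0%N](subrK (s k)) -[v 0%N - s k]scale1r.
  by apply: bdd_lin => //; case: (subS _ _ sv (ss k)).
Qed.

(* Gliding hump: a point [y = sum +- x_k], the sign chosen so that [T j_k] is at
   least [k] on the [k]-th partial sum (one of [T (s + x)], [T (s - x)] is at
   least [T x] in modulus), and the next terms chosen small against [T j_k]. *)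
Lemma uniform_boundedness M c a K (T : nat -> (R -> C) -> C) :
  (forall p, 0 < M p) -> 0 < a ->
  (forall j (z : C) phi psi, inD M c a K phi -> inD M c a K psi ->
     T j (z *: phi + psi) = z * T j phi + T j psi) ->
  (forall j, exists n B, forall phi, inD M c a K phi ->
     bdd M (lev c a n) 1 phi -> cabs (T j phi) <= B) ->
  (forall phi, inD M c a K phi -> exists B, forall j, cabs (T j phi) <= B) ->
  exists n B, forall j phi, inD M c a K phi -> bdd M (lev c a n) 1 phi ->
    cabs (T j phi) <= B.
Proof.
move=> M_gt0 a0 Tlin Tcont Tpt; apply: contrapT => Hno.
have TZ j (z : C) phi : inD M c a K phi -> T j (z *: phi) = z * T j phi.
  move=> Hp.
  have T0 : T j 0 = 0.
    exact: eq0_lin0 (Tlin j 1 0 0 (inD0 c K M_gt0 a0) (inD0 c K M_gt0 a0)).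
  by rewrite -[_ *: _]addr0 Tlin ?T0 ?addr0//; exact: inD0.
pose P (n : nat) (d : R) (k : nat) (jx : nat * (R -> C)) :=
  [/\ inD M c a K jx.2, bdd M (lev c a n) d jx.2 & k%:R <= cabs (T jx.1 jx.2)].
have pickP n (d : R) k : 0 < d -> exists jx, P n d k jx.
  move=> d_gt0; apply: contrapT => Hn; apply: Hno; exists n, (k%:R / d) => j phi Hp bp.
  rewrite leNgt; apply/negP => Hlt; apply: Hn; exists (j, d%:C *: phi); split => /=.
  - exact: inD_scale.
  - have := bdd_scale d%:C M_gt0 (lev_gt0 c n a0) _ bp.
    by rewrite cabs_real mulr1 gtr0_norm//; apply; case: Hp.
  - rewrite TZ// cabsM cabs_real gtr0_norm// mulrC -ler_pdivrMr//.
    exact: ltW.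
have [pick Hpick] : exists pick : nat -> R -> nat -> nat * (R -> C),
    forall n d k, 0 < d -> P n d k (pick n d k).
  suff H n (d : R) k : exists jx, 0 < d -> P n d k jx.
    exists (fun n d k => projT1 (cid (H n d k))) => n d k.
    exact: projT2 (cid (H n d k)).
  have [/pickP -/(_ n k) [jx Hjx]|dn] := boolP (0 < d); first by exists jx.
  by exists (0%N, 0).
have [nB HnB] : exists nB : nat -> nat * R, forall j, 0 < (nB j).2 /\
    forall phi (b : R), 0 < b -> inD M c a K phi -> bdd M (lev c a (nB j).1) b phi ->
    cabs (T j phi) <= (nB j).2 * b.
  suff H j : exists nB : nat * R, 0 < nB.2 /\
    forall phi (b : R), 0 < b -> inD M c a K phi -> bdd M (lev c a nB.1) b phi ->
    cabs (T j phi) <= nB.2 * b.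
    exists (fun j => projT1 (cid (H j))) => j; exact: projT2 (cid (H j)).
  have [n [B HB]] := Tcont j; exists (n, `|B| + 1) => /=; split.
    by rewrite ltr_wpDl.
  move=> phi b b0 Hp bp.
  have K1 : bdd M (lev c a n) 1 (b^-1%:C *: phi).
    have := bdd_scale b^-1%:C M_gt0 (lev_gt0 c n a0) _ bp.
    rewrite cabs_real gtr0_norm ?invr_gt0// mulVf ?gt_eqF//.
    by apply; case: Hp.
  have := HB _ (inD_scale b^-1%:C M_gt0 a0 Hp) K1.
  rewrite TZ// cabsM cabs_real gtr0_norm ?invr_gt0// mulrC ler_pdivrMr// => H.
  apply: le_trans H _; rewrite ler_wpM2r ?(ltW b0)//.
  by apply: le_trans (ler_norm _) _; rewrite lerDl.
(* The state holds the norm index, the size allowed for the next term and the partial sum. The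
   [maxn] forces later terms to be measured in a norm controlling the current functional, with
   constant [(nB jx.1).2]. The tail has size at most 4 times the new [d], so the second term of the
   minimum lets it move that functional by at most 1. *)
pose step (k : nat) (st : nat * R * (R -> C)) :=
  let: (n, d, x) := st in
  let jx := pick n d k in
  (maxn n.+1 (nB jx.1).1, Num.min (d / 2) (4 * (nB jx.1).2)^-1,
   if k%:R <= cabs (T jx.1 (x + jx.2)) then x + jx.2 else x - jx.2).
pose S := fix S k := if k is k'.+1 then step k' (S k') else (0%N, 1 : R, 0 : R -> C).
pose n k := (S k).1.1; pose d k := (S k).1.2; pose s k := (S k).2.
pose jx k := pick (n k) (d k) k.
have SE k : S k = (n k, d k, s k) by rewrite /n /d /s; case: (S k) => -[].
have nS k : n k.+1 = maxn (n k).+1 (nB (jx k).1).1 by rewrite {1}/n /= SE.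
have dS k : d k.+1 = Num.min (d k / 2) (4 * (nB (jx k).1).2)^-1.
  by rewrite {1}/d /= SE.
have sS k : s k.+1 = if k%:R <= cabs (T (jx k).1 (s k + (jx k).2))
    then s k + (jx k).2 else s k - (jx k).2 by rewrite {1}/s /= SE.
have d_gt0 k : 0 < d k.
  elim: k => [|k IH]; first exact: ltr01.
  rewrite dS lt_min divr_gt0//= invr_gt0 mulr_gt0//.
  by case: (HnB (jx k).1).
have HP k : P (n k) (d k) k (jx k) by exact: Hpick.
have dn k : d k.+1 <= d k / 2 by rewrite dS ge_min lexx.
have nn k : (n k <= n k.+1)%N by rewrite nS leq_max leqW.
have kn k : (k <= n k)%N.
  by elim: k => [//|k IH]; rewrite nS leq_max ltnS IH.
have sD k : inD M c a K (s k).
  elim: k => [|k IH]; first exact: inD0.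
  have [Hj _ _] := HP k; rewrite sS; case: ifP => _.
    by rewrite addrC -[_.2]scale1r; exact: inD_lin.
  by rewrite addrC -scaleN1r; exact: inD_lin.
have sb k : bdd M (lev c a (n k)) (d k) (s k.+1 - s k).
  have [Hj bj _] := HP k; rewrite sS; case: ifP => _.
    by rewrite addrC addKr.
  rewrite addrAC subrr sub0r -scaleN1r.
  have := bdd_scale (-1) M_gt0 (lev_gt0 c (n k) a0) _ bj.
  by rewrite cabsN cabs1 mul1r; apply; case: Hj.
have [y yD Hy] := inD_complete M_gt0 a0 sD nn kn dn sb.
have [B HB] := Tpt y yD.
have big k : k%:R <= cabs (T (jx k).1 (s k.+1)).
  have [Hj _ Tk] := HP k; rewrite sS; case: ifPn => //.
  rewrite -ltNge => Hlt.
  have E1 : T (jx k).1 (s k + (jx k).2) = T (jx k).1 (jx k).2 + T (jx k).1 (s k).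
    by rewrite addrC -[X in X + _]scale1r Tlin// mul1r.
  have E2 : T (jx k).1 (s k - (jx k).2) = - T (jx k).1 (jx k).2 + T (jx k).1 (s k).
    by rewrite addrC -scaleN1r Tlin// mulN1r.
  have : cabs (T (jx k).1 (jx k).2 *+ 2) <=
      cabs (T (jx k).1 (s k + (jx k).2)) + cabs (T (jx k).1 (s k - (jx k).2)).
    rewrite [X in cabs X](_ : _ = T (jx k).1 (s k + (jx k).2) -
      T (jx k).1 (s k - (jx k).2)); first exact: cabs_triangleB.
    by rewrite E1 E2; ring.
  have -> : cabs (T (jx k).1 (jx k).2 *+ 2) = 2 * cabs (T (jx k).1 (jx k).2).
    rewrite (_ : _ *+ 2 = (2 : R)%:C * T (jx k).1 (jx k).2).
      by rewrite cabsM cabs_real ger0_norm.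
    by rewrite rmorph_nat mulr_natl.
  lra.
have up k : k%:R <= B + 1.
  apply: le_trans (big k) _.
  have [nB0 HnBk] := HnB (jx k).1.
  have yk : inD M c a K (y - s k.+1).
    by rewrite addrC -scaleN1r; exact: inD_lin.
  rewrite (_ : s k.+1 = (-1) *: (y - s k.+1) + y); last first.
    by rewrite scaleN1r opprB subrK.
  rewrite Tlin// mulN1r; apply: le_trans (cabs_triangle _ _) _.
  rewrite addrC cabsN lerD//.
  have : bdd M (lev c a (nB (jx k).1).1) (4 * d k.+1) (y - s k.+1).
    apply: bdd_le (Hy k.+1) => //; first exact: lev_gt0.
    by apply: lev_le => //; rewrite nS leq_max leqnn orbT.
  move=> /(HnBk _ _ _ yk) H; apply: le_trans (H _) _; first by rewrite mulr_gt0.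
  rewrite mulrA (mulrC _ 4) -ler_pdivlMl ?mulr_gt0// mulr1.
  by rewrite dS ge_min lexx orbT.
have := up (Num.truncn (B + 1)).+1.
by rewrite leNgt truncnS_gt.
Qed.

End test_functions.

(** * Seminorm description of the spaces and their duals *)

Section ultra_limits.
Context (R : realType).
Local Notation C := R[i].
Local Notation E := (R -> C).
Context (I : Type) (D0 : set I) (A : I -> set E) (N : I -> R -> E -> \bar R).
Context (P : I -> R -> R -> E -> Prop) (c : ultra_class).
Hypothesis NP : forall i (l b : R) phi, 0 < l -> ((N i l phi <= b%:E)%E <-> P i l b phi).
Hypothesis PS : forall i (l l' b b' : R) phi, 0 < l -> l <= l' -> b <= b' ->
  P i l b phi -> P i l' b' phi.
Hypothesis AP0 : forall i l, A i 0 /\ P i l 0 0.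

(** The common shape of the steps of both spaces: [i] is a compact set for [D_space] and a growth
    exponent for [K_space], and [P i l b] is the norm bound written out pointwise. *)
Definition in_level i (a : R) phi := A i phi /\ forall n, exists b, P i (lev c a n) b phi.

Let U i := ultra_lim c (fun l => lcs_normed (A i) (N i l)).
Let X := lcs_indlim D0 U.

Lemma norm_lty i l phi : 0 < l -> (N i l phi < +oo)%E <-> exists b, P i l b phi.
Proof.
move=> l0; split=> [|[b /(NP _ _ _ l0)]]; last by move=> H; exact: le_lt_trans H (ltry _).
case EN : (N i l phi) => [r| |] // _; first by exists r; apply/NP => //; rewrite EN.
by exists 0; apply/NP => //; rewrite EN leNye.
Qed.

Lemma lev_small (l a : R) : 0 < l -> exists n, lev Beurling a n <= l.
Proof.
move=> l0; exists (Num.truncn (a / l)).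
rewrite /lev ler_pdivrMr// mulrC -ler_pdivrMr// ltW//.
exact: truncnS_gt.
Qed.

Lemma in_levelP i a l phi : c = Beurling -> 0 < a -> 0 < l ->
  in_level i a phi -> exists b, P i l b phi.
Proof.
move=> cB a0 l0 [_ H]; have [n Hn] := lev_small a l0; have [b] := H n.
rewrite cB => Hb; exists b; apply: PS Hb => //; exact: lev_gt0.
Qed.

Lemma ultra_lim_carrier i phi :
  lcs_carrier (U i) phi <-> exists2 a, 0 < a & in_level i a phi.
Proof.
rewrite /U /in_level; case cE : c => /=; split.
- move=> H; exists 1 => //; split.
    by case: (H 1 ltr01).
  move=> n; have l0 := lev_gt0 Beurling n (@ltr01 R).
  by apply/norm_lty => //; case: (H _ l0).
- move=> [a a0 [Ap Hp]] l /= l0; split=> //; apply/norm_lty => //.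
  by apply: (in_levelP cE a0 l0); split=> //; rewrite cE.
- move=> [l /= l0 [Ap Hp]]; exists l => //; split=> // n.
  by rewrite /lev mulr1; apply/norm_lty.
- move=> [a a0 [Ap Hp]]; exists a => //; split=> //=; apply/norm_lty => //.
  by have := Hp 0%N; rewrite /lev mulr1.
Qed.

(** The smallest of finitely many scales carries the strongest norm. The radii are halved because
    [P] encodes a non-strict bound while basic neighbourhoods are strict. *)
Lemma finite_steps i (V : R -> set E) (s : seq R) :
  (forall l, l \in s -> 0 < l /\ lcs_nbhs0 (lcs_normed (A i) (N i l)) (V l)) ->
  exists l0 e : R, [/\ 0 < l0, 0 < e & forall phi, A i phi -> P i l0 e phi ->
    forall l, l \in s -> V l phi].
Proof.
elim: s => [_|l s IH H]; first by exists 1, 1.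
have [|l0 [e [l00 e0 He]]] := IH.
  by move=> k ks; apply: H; rewrite inE ks orbT.
have [lpos [e1 e10 He1]] := H l (mem_head _ _).
exists (Num.min l l0), (Num.min (e1 / 2) e); split.
- by rewrite lt_min lpos.
- by rewrite lt_min e0 divr_gt0.
- move=> phi Ap Pp k; rewrite inE => /predU1P[->|ks]; last first.
    apply: He => //; apply: PS Pp; rewrite ?ge_min ?lexx ?orbT//.
    by rewrite lt_min lpos.
  have Pl : (N i l phi <= (e1 / 2)%:E)%E.
    apply/NP => //; apply: PS Pp; rewrite ?ge_min ?lexx//.
    by rewrite lt_min lpos.
  apply: He1; split; last by apply: le_lt_trans Pl _; rewrite lte_fin; lra.
  by split=> //; apply: le_lt_trans Pl (ltry _).
Qed.

Lemma ultra_lim_nbhs i V a : lcs_nbhs0 (U i) V -> 0 < a ->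
  exists n (e : R), 0 < e /\ forall phi, in_level i a phi ->
    P i (lev c a n) e phi -> V phi.
Proof.
rewrite /U /in_level; case cE : c => /=.
- move=> [J [W [/finite_seqP[s Js] JD HW HV]]] a0.
  have [|l0 [e [l00 e0 He]]] := @finite_steps i W s.
    move=> l ls; have Jl : J l by rewrite Js.
    by split; [exact: JD|exact: HW].
  have [n Hn] := lev_small a l00.
  exists n, e; split=> // phi [Ap Hp] Pp; apply: HV; split.
    move=> l /= l0'; split=> //; apply/norm_lty => //.
    by apply: (in_levelP cE a0 l0'); split=> //; rewrite cE.
  move=> l; rewrite Js /= => ls; apply: He => //.
  by apply: PS Pp => //; exact: lev_gt0.
- move=> [W [_ _ HW HV]] a0; have [e e0 He] := HW a a0.
  exists 0%N, (e / 2); split; first exact: divr_gt0.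
  move=> phi [Ap _]; rewrite /lev mulr1 => /NP -/(_ a0) Pp.
  apply: HV; apply: He => /=; split; last by apply: le_lt_trans Pp _; rewrite lte_fin; lra.
  by split=> //; apply: le_lt_trans Pp (ltry _).
Qed.

(** A neighbourhood in an inductive limit has to contain an absolutely convex one, whence the first
    hypothesis; in the projective limit the single scale [lev Beurling 1 n] suffices. *)
Lemma nbhs_ultra_lim i V : absolutely_convex (V `&` lcs_carrier (U i)) ->
  (forall a, 0 < a -> exists n (e : R), 0 < e /\ forall phi, in_level i a phi ->
    P i (lev c a n) e phi -> V phi) ->
  lcs_nbhs0 (U i) V.
Proof.
move=> acV HV; have Ucar := ultra_lim_carrier i.
have NS l e phi : 0 < l -> 
    (A i phi /\ (N i l phi < +oo)%E) /\ (N i l phi < e%:E)%E -> P i l e phi.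
  by move=> l0 [_ /ltW H]; apply/NP.
move: acV HV Ucar; rewrite /U /in_level; case cE : c => /= acV HV Ucar.
- have [n [e [e0 He]]] := HV 1 ltr01.
  have l0 := lev_gt0 Beurling n (@ltr01 R).
  exists [set lev Beurling 1 n], (fun l => [set phi |
    (A i phi /\ (N i l phi < +oo)%E) /\ (N i l phi < e%:E)%E]); split=> //.
  + by move=> _ ->.
  + by move=> l _; exists e => //; move=> phi.
  + move=> phi [Yp /(_ _ erefl) Hp]; apply: He; last exact: NS Hp.
    split; first by case: (Yp 1 ltr01).
    move=> k; apply/norm_lty; first exact: lev_gt0.
    by case: (Yp (lev Beurling 1 k)) => //; exact: (lev_gt0 Beurling k ltr01).
- exists (V `&` \bigcup_(l in [set l | 0 < l])
    [set phi | A i phi /\ (N i l phi < +oo)%E]).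
  split=> //; try by move=> ? [].
  move=> l l0; have [n [e [e0 He]]] := HV l l0; exists e => //.
  move=> phi Hp; split; last by exists l => //; case: Hp.
  apply: He; last by rewrite /lev mulr1; exact: NS.
  split; first by case: Hp => -[].
  by move=> k; rewrite /lev mulr1; exists e; exact: NS.
Qed.

Lemma lcs_dual_bound f i a : lcs_dual X f -> D0 i -> 0 < a ->
  exists n (e : R), 0 < e /\ forall phi, in_level i a phi ->
    P i (lev c a n) e phi -> cabs (f phi) <= 1.
Proof.
move=> [flin fcont] Di a0.
have c0 : lcs_carrier X 0.
  exists i => //; apply/ultra_lim_carrier; exists 1 => //; split.
    by case: (AP0 i 1).
  by move=> n; exists 0; case: (AP0 i (lev c 1 n)).
have f0 : f 0 = 0.
  exact: eq0_lin0 (flin 1 0 0 c0 c0).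
have [V [_ _ HV VU]] := fcont 0 c0 _ (nbhsx_ballx (f 0 : Rcomplex R) 1 ltr01).
have [n [e [e0 He]]] := ultra_lim_nbhs (HV i Di) a0.
exists n, e; split=> // phi lp Pp.
have := VU _ (He _ lp Pp); rewrite /= add0r f0 -ball_normE /= sub0r => /ltW.
by rewrite (@normrN _ (Rcomplex R)).
Qed.

(** Continuity on an inductive limit is boundedness on each step: a sublevel set of the modulus of
    [f] is absolutely convex, and the bound on a step makes it a neighbourhood there. *)
Lemma lcs_dualI f :
  (forall (z : C) phi psi, lcs_carrier X phi -> lcs_carrier X psi ->
     lcs_carrier X (z *: phi + psi) /\ f (z *: phi + psi) = z * f phi + f psi) ->
  (forall i (z : C) phi psi, D0 i -> lcs_carrier (U i) phi -> lcs_carrier (U i) psi ->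
     lcs_carrier (U i) (z *: phi + psi)) ->
  (forall i a, D0 i -> 0 < a -> exists n (B : R), forall b phi, 0 < b ->
     in_level i a phi -> P i (lev c a n) b phi -> cabs (f phi) <= B * b) ->
  lcs_dual X f.
Proof.
move=> flin Ulin fb; split=> [z phi psi Hp Hq|phi Hphi S].
  by case: (flin z _ _ Hp Hq).
move=> /nbhs_ballP[e /= e0 He].
have e2 : 0 < e / 2 by exact: divr_gt0.
have c0 psi : lcs_carrier X psi -> lcs_carrier X 0.
  move=> Hpsi; have [] := flin (-1) _ _ Hpsi Hpsi.
  by rewrite scaleN1r addNr.
have fZ (z : C) psi : lcs_carrier X psi -> f (z *: psi) = z * f psi.
  move=> Hp; have H0 := c0 _ Hp; have [_ /eq0_lin0 f0] := flin 1 _ _ H0 H0.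
  by have [_] := flin z _ _ Hp H0; rewrite f0 !addr0.
have ineq (z w : C) phi1 phi2 : `|z| + `|w| <= 1 ->
    lcs_carrier X phi1 -> lcs_carrier X phi2 ->
    cabs (f phi1) <= e / 2 -> cabs (f phi2) <= e / 2 ->
    lcs_carrier X (z *: phi1 + w *: phi2) /\
    cabs (f (z *: phi1 + w *: phi2)) <= e / 2.
  move=> zw H1 H2 f1 f2.
  have H2' : lcs_carrier X (w *: phi2).
    by have [] := flin w _ _ H2 (c0 _ H2); rewrite addr0.
  have [? ->] := flin z _ _ H1 H2'; split=> //.
  rewrite fZ//; apply: le_trans (cabs_triangle _ _) _; rewrite !cabsM.
  have {}zw : cabs z + cabs w <= 1.
    by move: zw; rewrite !normC_cabs -rmorphD -(lecR _ 1).
  apply: le_trans (_ : (cabs z + cabs w) * (e / 2) <= _).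
    by rewrite mulrDl lerD// ler_wpM2l// cabs_ge0.
  by rewrite ler_piMl// ltW.
exists [set u | lcs_carrier X u /\ cabs (f u) <= e / 2]; split.
- by move=> u [].
- move=> z w phi1 phi2 zw [H1 f1] [H2 f2]; exact: ineq.
- move=> i Di; apply: nbhs_ultra_lim => [z w phi1 phi2 zw|a a0].
    move=> [[H1 f1] U1] [[H2 f2] U2]; split; first exact: ineq.
    have U0 : lcs_carrier (U i) 0.
      by have := Ulin i (-1) _ _ Di U1 U1; rewrite scaleN1r addNr.
    by apply: (Ulin) => //; rewrite -[_ *: _]addr0; exact: Ulin.
  have [n [B HB]] := fb i a Di a0.
  have B0 : 0 < `|B| + 1 by rewrite ltr_wpDl.
  have b0 : 0 < e / 2 / (`|B| + 1) by rewrite divr_gt0.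
  exists n, (e / 2 / (`|B| + 1)); split => // psi lp Pp.
  split; first by exists i => //; apply/ultra_lim_carrier; exists a.
  apply: le_trans (HB _ _ b0 lp Pp) _.
  rewrite mulrCA ler_piMr ?(ltW e2)// ler_pdivrMr// mul1r.
  by apply: le_trans (ler_norm _) _; rewrite lerDl.
- move=> u [Xu fu]; apply: He; rewrite -ball_normE /=.
  have [_] := flin 1 _ _ Hphi Xu; rewrite scale1r mul1r => ->.
  rewrite opprD addrA subrr sub0r (@normrN _ (Rcomplex R)).
  by apply: le_lt_trans fu _; lra.
Qed.

End ultra_limits.

(** * The concrete test spaces and bounds for their functionals *)

Section spaces.
Context (R : realType) (M : nat -> R) (c : ultra_class).
Hypothesis M_gt0 : forall p, 0 < M p.
Local Notation C := R[i].
Implicit Types (phi psi : R -> C) (K : set R).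

Lemma weight_step_le (l l' b b' z : R) m : 0 < l -> l <= l' -> b <= b' ->
  0 <= z -> z <= b * (l ^+ m * M m) -> z <= b' * (l' ^+ m * M m).
Proof.
move=> l0 ll bb z0 H.
have W0 : 0 < l ^+ m * M m by rewrite mulr_gt0 ?exprn_gt0.
have b0 : 0 <= b by rewrite -(pmulr_lge0 b W0) (le_trans z0).
apply: le_trans H _; apply: ler_pM => //; first exact: ltW.
apply: ler_wpM2r; first exact: ltW.
by rewrite lerXn2r ?nnegrE// ltW// (lt_le_trans l0).
Qed.

Lemma weight_ge0 (l b z : R) m : 0 < l ->
  0 <= z -> z <= b * (l ^+ m * M m) -> 0 <= b.
Proof.
move=> l0 z0 H; have W0 : 0 < l ^+ m * M m by rewrite mulr_gt0 ?exprn_gt0.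
by rewrite -(pmulr_lge0 b W0) (le_trans z0).
Qed.

Lemma ereal_sup_le_EFin (T : Type) (S : set T) (h : T -> \bar R) (b : \bar R) :
  (ereal_sup [set h t | t in S] <= b)%E <-> forall t, S t -> (h t <= b)%E.
Proof.
split=> [H t St|H]; last by apply: ge_ereal_sup => _ [t St <-]; exact: H.
by apply: le_trans H; apply: ereal_sup_ubound; exists t.
Qed.

Definition bdd_on K (l b : R) phi : Prop :=
  forall m x, K x -> cabs (cderiven m phi x) <= b * (l ^+ m * M m).

Lemma D_norm_le K (l b : R) phi : 0 < l ->
  (D_norm M l K phi <= b%:E)%E <-> bdd_on K l b phi.
Proof.
move=> l0; have W0 m : 0 < l ^+ m * M m by rewrite mulr_gt0 ?exprn_gt0.
rewrite /D_norm ereal_sup_le_EFin; split.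
  move=> H m x Kx; move/ereal_sup_le_EFin: (H m Logic.I) => /(_ x Kx).
  by rewrite lee_fin ler_pdivrMr.
move=> H m _; apply/ereal_sup_le_EFin => x Kx; rewrite lee_fin ler_pdivrMr//.
exact: H.
Qed.

Lemma bdd_onS K (l l' b b' : R) phi : 0 < l -> l <= l' -> b <= b' ->
  bdd_on K l b phi -> bdd_on K l' b' phi.
Proof.
move=> l0 ll bb H m x Kx; apply: weight_step_le (H m x Kx) => //.
exact: cabs_ge0.
Qed.

Lemma supported_inP K phi : closed K ->
  supported_in K phi <-> forall x, ~ K x -> phi x = 0.
Proof.
move=> cK; split=> [H x Kx|H].
  apply/eqP/negP => /negP px; apply/Kx/H; exact: subset_closure.
rewrite /supported_in; apply: subset_trans (_ : closure K `<=` K); last exact: cK.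
apply: closure_subset => x /= /eqP px; apply: contrapT => /H; exact: px.
Qed.

Let AD K : set (R -> C) := [set phi | csmooth phi /\ supported_in K phi].

Let AP0D K (l : R) : AD K (0 : R -> C) /\
  bdd_on K l 0 0.
Proof.
split; first split.
- by have [] := inD0 c setT M_gt0 (@ltr01 R).
- move=> x; rewrite (_ : [set _ | _] = set0) ?closure0//.
  by apply/seteqP; split=> y //=; rewrite eqxx.
- by move=> m x _; rewrite cderiven0 cabs0 mul0r.
Qed.

Lemma in_level_D K a phi : closed K -> 0 < a ->
  in_level AD bdd_on c K a phi <-> inD M c a K phi.
Proof.
move=> cK a0; split=> [[[sp /(supported_inP _ cK) p0] Hb]|[sp p0 Hb]].
(* If [K] is empty, [b] may be negative; [|b|] also serves off [K], where all derivatives vanish. *)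
- split=> // n; have [b Hn] := Hb n; exists `|b| => m x.
  have [Kx|/(cderiven_off m sp cK p0) ->] := pselect (K x).
    apply: le_trans (Hn m x Kx) _; rewrite ler_wpM2r ?ler_norm//.
    by rewrite mulr_ge0 ?exprn_ge0 ?ltW ?lev_gt0.
  by rewrite cabs0 !mulr_ge0 ?exprn_ge0 ?(ltW (lev_gt0 _ _ a0))// ltW.
- split; first by split=> //; exact/supported_inP.
  by move=> n; have [b Hn] := Hb n; exists b => m x _; exact: Hn.
Qed.

Let D_step_carrierP K phi :
  lcs_carrier (ultra_lim c (fun l => D_step M l K)) phi <->
  exists2 a, 0 < a & in_level AD bdd_on c K a phi.
Proof. exact: (ultra_lim_carrier AD c (@D_norm_le) bdd_onS). Qed.

Lemma D_carrierP phi : lcs_carrier (D_space c M) phi <->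
  exists K a, [/\ compact K, 0 < a & inD M c a K phi].
Proof.
split.
- move=> [K cK /D_step_carrierP[a a0 H]].
  exists K, a; split=> //; apply/in_level_D => //.
  exact: compact_closed.
- move=> [K [a [cK a0 H]]]; exists K => //.
  apply/D_step_carrierP; exists a => //.
  by apply/in_level_D => //; exact: compact_closed.
Qed.

Lemma D_dual_bound f K a : lcs_dual (D_space c M) f -> compact K -> 0 < a ->
  exists n (B : R), 0 < B /\ forall phi b, 0 < b -> inD M c a K phi ->
    bdd M (lev c a n) b phi -> cabs (f phi) <= B * b.
Proof.
move=> fD cK a0.
have [n [e [e0 He]]] := lcs_dual_bound (@D_norm_le) bdd_onS AP0D fD cK a0.
exists n, e^-1; split; first by rewrite invr_gt0.
move=> phi b b0 Hp bp; have z0 : 0 < e / b by rewrite divr_gt0.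
have K1 : bdd M (lev c a n) e ((e / b)%:C *: phi).
  have := bdd_scale (e / b)%:C M_gt0 (lev_gt0 c n a0) _ bp.
  rewrite cabs_real gtr0_norm// divfK ?gt_eqF//.
  by apply; case: Hp.
have Hz := inD_scale (e / b)%:C M_gt0 a0 Hp.
have c0 : lcs_carrier (D_space c M) 0 by apply/D_carrierP; exists K, a; split=> //; exact: inD0.
have cp : lcs_carrier (D_space c M) phi by apply/D_carrierP; exists K, a.
have f0 : f 0 = 0.
  exact: eq0_lin0 (fD.1 1 0 0 c0 c0).
have := He ((e / b)%:C *: phi); rewrite -[X in f X]addr0 fD.1// f0 addr0.
rewrite cabsM cabs_real gtr0_norm// => H.
have : e / b * cabs (f phi) <= 1.
  apply: H; first by apply/in_level_D => //; exact: compact_closed.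
  by move=> m x _; exact: K1.
by rewrite -ler_pdivlMl// invf_div mulr1 mulrC.
Qed.

(** The integer power [(1 + |x|)^(m - q)] is split into natural powers on the two sides, which
    avoids negative exponents. *)
Definition kbdd (q : nat) (l b : R) phi : Prop := forall m x,
  (1 + `|x|) ^+ m * cabs (cderiven m phi x) <=
    b * (l ^+ m * M m) * (1 + `|x|) ^+ q.

Lemma K_norm_le q (l b : R) phi : 0 < l ->
  (K_norm M l q phi <= b%:E)%E <-> kbdd q l b phi.
Proof.
move=> l0; have W0 m : 0 < l ^+ m * M m by rewrite mulr_gt0 ?exprn_gt0.
have E m x : ((1 + `|x|) ^ (m%:Z - q%:Z) * cabs (cderiven m phi x) /
    (l ^+ m * M m) <= b) = ((1 + `|x|) ^+ m * cabs (cderiven m phi x) <=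
    b * (l ^+ m * M m) * (1 + `|x|) ^+ q).
  have x0 : 0 < 1 + `|x| by rewrite ltr_pwDl.
  rewrite ler_pdivrMr// expfzDr ?gt_eqF// -exprnP -exprnN mulrAC.
  by rewrite ler_pdivrMr ?exprn_gt0.
rewrite /K_norm ereal_sup_le_EFin; split.
  move=> H m x; move/ereal_sup_le_EFin: (H m Logic.I) => /(_ x Logic.I).
  by rewrite lee_fin E.
by move=> H m _; apply/ereal_sup_le_EFin => x _; rewrite lee_fin E; exact: H.
Qed.

Lemma kbddS q (l l' b b' : R) phi : 0 < l -> l <= l' -> b <= b' ->
  kbdd q l b phi -> kbdd q l' b' phi.
Proof.
move=> l0 ll bb H m x.
have x0 : 0 < (1 + `|x|) ^+ q by rewrite exprn_gt0 ?ltr_pwDl.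
rewrite -ler_pdivrMr//; apply: weight_step_le l0 ll bb _ _.
  by rewrite !mulr_ge0 ?cabs_ge0 ?exprn_ge0 ?invr_ge0 ?addr_ge0// ltW.
by rewrite ler_pdivrMr.
Qed.

Definition inK (q : nat) (a : R) phi := csmooth phi /\
  forall n, exists b, kbdd q (lev c a n) b phi.

Lemma kbdd_lin q (l b b' : R) (z : C) phi psi : csmooth phi -> csmooth psi ->
  kbdd q l b phi -> kbdd q l b' psi ->
  kbdd q l (cabs z * b + b') (z *: phi + psi).
Proof.
move=> sp sq Hp Hq m x; have [_ ->] := csmooth_lin z sp sq.
have x0 : 0 <= (1 + `|x|) ^+ m by rewrite exprn_ge0 ?addr_ge0.
apply: le_trans (ler_wpM2l x0 (cabs_triangle _ _)) _.
rewrite mulrDr 2!mulrDl lerD// cabsM mulrCA -!mulrA ler_wpM2l ?cabs_ge0//.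
by have := Hp m x; rewrite -!mulrA.
Qed.

Lemma kbdd0 q (l : R) : kbdd q l 0 0.
Proof. by move=> m x; rewrite cderiven0 cabs0 !mul0r mulr0. Qed.

Lemma inK_lin q a (z : C) phi psi : inK q a phi -> inK q a psi ->
  inK q a (z *: phi + psi).
Proof.
move=> [sp Hp] [sq Hq]; split; first by case: (csmooth_lin z sp sq).
move=> n; have [b Hb] := Hp n; have [b' Hb'] := Hq n.
by exists (cabs z * b + b'); exact: kbdd_lin.
Qed.

Lemma lev_le_scale (a a' : R) n : a <= a' -> lev c a n <= lev c a' n.
Proof. by move=> aa; rewrite ler_wpM2r//; case: c. Qed.

Lemma inK_le q q' (a a' : R) phi : (q <= q')%N -> 0 < a -> a <= a' ->
  inK q a phi -> inK q' a' phi.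
Proof.
move=> qq a0 aa [sp Hp]; split=> // n; have [b Hb] := Hp n.
have l0 := lev_gt0 c n a0; exists `|b|.
apply: (kbddS (l := lev c a n) (b := `|b|)) => //; first exact: lev_le_scale.
move=> m x; apply: le_trans (Hb m x) _.
have W0 : 0 < lev c a n ^+ m * M m by rewrite mulr_gt0 ?exprn_gt0.
apply: ler_pM => //; last 2 first.
- by rewrite ler_wpM2r ?ler_norm// ltW.
- by rewrite ler_weXn2l// lerDl.
- rewrite mulr_ge0 ?(ltW W0)//.
  apply: (@weight_ge0 (lev c a n) b (cabs (cderiven 0 phi 0)) 0) => //.
    exact: cabs_ge0.
  by have := Hb 0%N 0; rewrite normr0 addr0 !expr1n mul1r mulr1.
Qed.

Let AP0K (q : nat) (l : R) : csmooth (0 : R -> C) /\ kbdd q l 0 0.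
Proof.
by split; [have [] := inD0 c setT M_gt0 (@ltr01 R)|exact: kbdd0].
Qed.

Let K_step_carrierP q phi :
  lcs_carrier (ultra_lim c (fun l => K_step M l q)) phi <->
  exists2 a, 0 < a & inK q a phi.
Proof. exact: (ultra_lim_carrier (fun=> csmooth (R := R)) c (@K_norm_le) kbddS). Qed.

Lemma K_carrierP phi : lcs_carrier (K_space c M) phi <->
  exists q a, 0 < a /\ inK q a phi.
Proof.
split.
- move=> [q _ /K_step_carrierP[a a0 H]].
  by exists q, a.
- move=> [q [a [a0 H]]]; exists q => //.
  by apply/K_step_carrierP; exists a.
Qed.

Lemma K_dual_bound f q a : lcs_dual (K_space c M) f -> 0 < a ->
  exists n (B : R), 0 < B /\ forall phi b, 0 < b -> inK q a phi ->
    kbdd q (lev c a n) b phi -> cabs (f phi) <= B * b.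
Proof.
move=> fK a0.
have [n [e [e0 He]]] := lcs_dual_bound (@K_norm_le) kbddS AP0K fK (Logic.I : [set: nat] q) a0.
exists n, e^-1; split; first by rewrite invr_gt0.
move=> phi b b0 Hp bp; have z0 : 0 < e / b by rewrite divr_gt0.
have s0 : csmooth (0 : R -> C) by case: (AP0K 0 0).
have K1 : kbdd q (lev c a n) e ((e / b)%:C *: phi).
  have := kbdd_lin (e / b)%:C Hp.1 s0 bp (kbdd0 q _).
  by rewrite cabs_real gtr0_norm// divfK ?gt_eqF// !addr0.
have i0 : inK q a 0 by split=> // k; exists 0; exact: kbdd0.
have Hz : inK q a ((e / b)%:C *: phi).
  by rewrite -[_ *: _]addr0; exact: inK_lin.
have c0 : lcs_carrier (K_space c M) 0 by apply/K_carrierP; exists q, a.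
have cp : lcs_carrier (K_space c M) phi by apply/K_carrierP; exists q, a.
have f0 : f 0 = 0.
  exact: eq0_lin0 (fK.1 1 0 0 c0 c0).
have := He _ Hz K1; rewrite -[X in f X]addr0 fK.1// f0 addr0.
rewrite cabsM cabs_real gtr0_norm//.
by rewrite -ler_pdivlMl// invf_div mulr1 mulrC.
Qed.

Lemma K_carrier_lin (z : C) phi psi : lcs_carrier (K_space c M) phi ->
  lcs_carrier (K_space c M) psi -> lcs_carrier (K_space c M) (z *: phi + psi).
Proof.
move=> /K_carrierP[q [a [a0 Hp]]] /K_carrierP[q' [a' [a0' Hq]]].
apply/K_carrierP; exists (maxn q q'), (Num.max a a'); split.
  by rewrite lt_max a0.
by apply: inK_lin; [apply: inK_le Hp|apply: inK_le Hq];
  rewrite ?leq_maxl ?leq_maxr// le_max lexx ?orbT.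
Qed.

Lemma K_dualI f :
  (forall (z : C) phi psi, lcs_carrier (K_space c M) phi ->
     lcs_carrier (K_space c M) psi -> f (z *: phi + psi) = z * f phi + f psi) ->
  (forall q a, 0 < a -> exists n (B : R), forall b phi, 0 < b ->
     inK q a phi -> kbdd q (lev c a n) b phi -> cabs (f phi) <= B * b) ->
  lcs_dual (K_space c M) f.
Proof.
move=> flin fb; apply: (lcs_dualI (@K_norm_le) kbddS).
- by move=> z phi psi Hp Hq; split; [exact: K_carrier_lin|exact: flin].
- move=> q z phi psi _.
  move=> /K_step_carrierP[a a0 Hp].
  move=> /K_step_carrierP[a' a0' Hq].
  apply/K_step_carrierP; exists (Num.max a a').
    by rewrite lt_max a0.
  by apply: inK_lin; [apply: inK_le Hp|apply: inK_le Hq];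
    rewrite // le_max lexx ?orbT.
- by move=> q a _ a0; have [n [B HB]] := fb q a a0; exists n, B.
Qed.

End spaces.

(** * Taylor remainders of dilations *)

Section dilations.
Context (R : realType) (M : nat -> R) (c : ultra_class).
Hypothesis M_gt0 : forall p, 0 < M p.
Local Notation C := R[i].
Implicit Types (phi psi : R -> C) (K : set R).

Definition dil (s : R) phi : R -> C := fun x => phi (s * x).

Lemma tower_affine (u : nat -> R -> C) (s t : R) : tower u ->
  tower (fun m x => (s ^+ m)%:C * u m (s * x + t)).
Proof.
move=> tu m x; apply: cder_ext (cderZ (s ^+ m)%:C (cder_affine (tu m (s * x + t)))) => //.
by rewrite exprSr rmorphM mulrA.
Qed.

Lemma csmooth_dil s phi : csmooth phi -> csmooth (dil s phi) /\
  forall m x, cderiven m (dil s phi) x = (s ^+ m)%:C * cderiven m phi (s * x) :> C.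
Proof.
move=> /csmooth_tower tp; have := tower_affine s 0 tp.
set u := (u in tower u) => tu.
have u0 : u 0%N = dil s phi.
  by apply/funext => x; rewrite /u expr0 mul1r addr0.
split; first by rewrite -u0; exact: tower_csmooth.
by move=> m x; rewrite -u0 (tower_cderiven m tu) /u addr0.
Qed.

Lemma bdd_dil s l b phi : 0 < s -> csmooth phi -> bdd M l b phi ->
  bdd M (s * l) b (dil s phi).
Proof.
move=> s0 sp H m x; have [_ ->] := csmooth_dil s sp.
rewrite cabsM cabs_real gtr0_norm ?exprn_gt0// exprMn.
have := H m (s * x); rewrite -(ler_pM2l (exprn_gt0 m s0)).
by rewrite -!mulrA mulrCA.
Qed.

Lemma inD_dil s a A phi : 0 < s -> inD M c a `[- A, A] phi ->
  inD M c (s * a) `[- (A / s), A / s] (dil s phi).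
Proof.
move=> s0 [sp p0 Hb]; split; first by case: (csmooth_dil s sp).
- move=> x; rewrite /= in_itv /= -ler_norml => /negP Hx; apply: p0.
  rewrite /= in_itv /= -ler_norml; apply/negP; apply: contra Hx.
  by rewrite normrM gtr0_norm// ler_pdivlMr// mulrC.
- move=> n; have [b Hn] := Hb n; exists b; rewrite levM; exact: bdd_dil.
Qed.

Lemma D_carrier_itvP phi : lcs_carrier (D_space c M) phi <->
  exists A a, [/\ 1 <= A, 0 < a & inD M c a `[- A, A] phi].
Proof.
split; last first.
  move=> [A [a [A1 a0 H]]]; apply/D_carrierP => //; exists `[- A, A]%classic, a.
  by split=> //; exact: segment_compact.
move=> /(D_carrierP c M_gt0)[K [a [cK a0 [sp p0 Hb]]]].
have [A0 [_ HA]] := compact_bounded cK.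
exists (`|A0| + 1), a; split=> //; first by rewrite lerDr.
split=> // x Hx; apply: p0 => Kx; apply: Hx.
rewrite /= in_itv /= -ler_norml; apply: HA Kx.
by rewrite (le_lt_trans (ler_norm _))// ltrDl.
Qed.

Lemma D_carrier_dil s phi : 0 < s -> lcs_carrier (D_space c M) phi ->
  lcs_carrier (D_space c M) (dil s phi).
Proof.
move=> s0 /D_carrier_itvP[A [a [A1 a0 H]]]; apply/D_carrierP => //.
exists `[- (A / s), A / s]%classic, (s * a); split; last exact: inD_dil.
- exact: segment_compact.
- exact: mulr_gt0.
Qed.

Lemma ler_sum_term (n j : nat) (F : nat -> R) : (forall i, 0 <= F i) ->
  (j < n)%N -> F j <= \sum_(i < n) F i.
Proof.
move=> F0 jn; rewrite (bigD1 (Ordinal jn))//= lerDl.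
by apply: sumr_ge0 => i _.
Qed.

Definition monomial (m : nat) : R -> C := fun x => x%:C ^+ m.

Lemma cder_monomial m (x : R) : cder (monomial m) x (m%:R * x%:C ^+ m.-1).
Proof.
have dx y : cder (fun y : R => y%:C) y 1 by exact: cder_real (is_derive_id y 1).
elim: m => [|m IH]; first by rewrite mul0r; exact: (cder_cst 1).
apply: cder_ext (cderM (dx x) IH) => [y|] /=; first by rewrite /monomial exprS.
rewrite mul1r mulrCA; case: m {IH} => [|m] /=; first by rewrite mul0r addr0 mul1r.
by rewrite -exprS -[in RHS]addn1 natrD mulrDl mul1r addrC.
Qed.

(** The falling factorial vanishes for [j > m], which makes the truncated difference [m - j]
    harmless. *)
Definition mono_tower (m j : nat) : R -> C := fun x => (m ^_ j)%:R * x%:C ^+ (m - j).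

Lemma tower_mono m : tower (mono_tower m).
Proof.
move=> j x; apply: cder_ext (cderZ (m ^_ j)%:R (cder_monomial (m - j) x)) => //.
by rewrite /mono_tower ffactnSr natrM mulrA subnS.
Qed.

Lemma mono_tower0 m : mono_tower m 0 = monomial m.
Proof. by apply/funext => x; rewrite /mono_tower ffactn0 mul1r subn0. Qed.

Lemma cabs_nat n : cabs (n%:R : C) = n%:R.
Proof. by rewrite -(rmorph_nat (real_complex R)) cabs_real ger0_norm. Qed.

(** This gives a meaning to the moments. Since [(1 + |x|)^j |x|^(m - j)] is at most [(1 + |x|)^m]
    and only orders up to [m] contribute, a finite constant works at every scale; the sum of the
    [F j] stands in for their maximum. *)
Lemma inK_monomial m a : 0 < a -> inK M c m a (monomial m).
Proof.
move=> a0; rewrite -mono_tower0; split; first exact: tower_csmooth (@tower_mono m).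
move=> n; have W0 j : 0 < lev c a n ^+ j * M j.
  by rewrite mulr_gt0 ?exprn_gt0 ?lev_gt0.
pose F j := (m ^_ j)%:R / (lev c a n ^+ j * M j).
have F0 j : 0 <= F j by rewrite divr_ge0// ltW.
exists (\sum_(j < m.+1) F j) => j x.
rewrite (tower_cderiven j (@tower_mono m)) /mono_tower cabsM cabs_nat cabsX cabs_real.
have [jm|mj] := leqP j m; last first.
  rewrite ffact_small// mul0r mulr0; apply: mulr_ge0.
    by rewrite mulr_ge0 ?(ltW (W0 j))// sumr_ge0.
  by rewrite exprn_ge0// addr_ge0.
have H : (m ^_ j)%:R <= (\sum_(j < m.+1) F j) * (lev c a n ^+ j * M j).
  by rewrite -ler_pdivrMr//; exact: ler_sum_term.
rewrite mulrCA; apply: ler_pM => //.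
rewrite -[in leRHS](subnKC jm) exprD ler_wpM2l ?exprn_ge0 ?addr_ge0//.
by rewrite lerXn2r ?nnegrE ?addr_ge0// lerDr.
Qed.

Definition taylor_coef phi (s : R) (m : nat) : C :=
  s%:C ^+ m * cderiven m phi 0 / (m`!)%:R.

Definition taylor_rem k phi (s : R) : R -> C := fun x =>
  dil s phi x - \sum_(m < k) taylor_coef phi s m * monomial m x.

Definition rem_tower k phi (s : R) (j : nat) : R -> C := fun x =>
  (s ^+ j)%:C * cderiven j phi (s * x)
  - \sum_(m < k) taylor_coef phi s m * mono_tower m j x.

Lemma cder_sum (n : nat) (F : nat -> R -> C) (d : nat -> C) (x : R) :
  (forall i, cder (F i) x (d i)) ->
  cder (fun y => \sum_(i < n) F i y) x (\sum_(i < n) d i).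
Proof.
move=> H; elim: n => [|n IH].
  rewrite big_ord0; apply: cder_ext (cder_cst 0 x) => // y; by rewrite big_ord0.
rewrite big_ord_recr; apply: cder_ext (cderD IH (H n)) => // y.
by rewrite big_ord_recr.
Qed.

Lemma rem_tower0 k phi s : rem_tower k phi s 0 = taylor_rem k phi s.
Proof.
apply/funext => x; rewrite /rem_tower /taylor_rem expr0 mul1r; congr (_ - _).
by apply: eq_bigr => i _; rewrite mono_tower0.
Qed.

Lemma tower_rem k phi s : csmooth phi -> tower (rem_tower k phi s).
Proof.
move=> /csmooth_tower tp j x.
have t1 := tower_affine s 0 tp j x.
have t2 := cderZ (-1) (cder_sum k (fun m => cderZ (taylor_coef phi s m) (tower_mono m j x))).
apply: cder_ext (cderD t1 t2) => [y|] /=; by rewrite /rem_tower mulN1r addr0.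
Qed.

Lemma rem_tower_at0 k phi s j : (j < k)%N -> rem_tower k phi s j 0 = 0.
Proof.
move=> jk; rewrite /rem_tower mulr0 (bigD1 (Ordinal jk))//= big1 ?addr0.
  rewrite /mono_tower subnn expr0 mulr1 /taylor_coef ffactnn divfK.
    by rewrite rmorphXn subrr.
  by rewrite pnatr_eq0 -lt0n fact_gt0.
move=> i; rewrite -val_eqE /= => ij; rewrite /mono_tower.
have [ji|ij'] := ltnP i j; first by rewrite ffact_small// mul0r mulr0.
by rewrite expr0n subn_eq0 leqNgt ltn_neqAle eq_sym ij ij' /= !mulr0.
Qed.

Lemma rem_tower_high k phi s j x : (k <= j)%N ->
  rem_tower k phi s j x = (s ^+ j)%:C * cderiven j phi (s * x).
Proof.
move=> kj; rewrite /rem_tower big1 ?subr0// => i _.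
by rewrite /mono_tower ffact_small ?mul0r ?mulr0// (leq_trans _ kj).
Qed.

(** Descend from order [k], where the Taylor polynomial has disappeared. All lower derivatives of
    the remainder vanish at 0, so each use of [cder_dist_le] from 0 costs a factor 2 and gains a
    factor [|x|]. *)
Lemma rem_tower_low k phi s (B : R) i : 0 < s -> csmooth phi ->
  (forall x, cabs (cderiven k phi x) <= B) -> (i <= k)%N ->
  forall x, cabs (rem_tower k phi s (k - i) x) <= 2 ^+ i * (B * s ^+ k) * `|x| ^+ i.
Proof.
move=> s0 sp HB; elim: i => [_ x|i IH ik x].
  rewrite subn0 rem_tower_high// cabsM cabs_real gtr0_norm ?exprn_gt0//.
  by rewrite !expr0 mul1r mulr1 mulrC ler_wpM2r// exprn_ge0// ltW.
have Hi : (k - i.+1).+1 = (k - i)%N by rewrite -subSn// subSS.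
have tr := tower_rem k s sp (k - i.+1)%N.
have B0 : 0 <= B by apply: le_trans (HB 0); exact: cabs_ge0.
have := cder_dist_le (x0 := 0) (x := x) (B := 2 ^+ i * (B * s ^+ k) * `|x| ^+ i) tr.
rewrite rem_tower_at0 ?subr0; last by rewrite Hi leq_subr.
move=> H; apply: le_trans (H _) _ => [y|].
  rewrite !subr0 Hi => yx; apply: le_trans (IH (ltnW ik) y) _.
  rewrite ler_wpM2l ?mulr_ge0 ?exprn_ge0 ?(ltW s0)//.
  by rewrite lerXn2r ?nnegrE.
by rewrite !exprS le_eqVlt; apply/orP; left; apply/eqP; ring.
Qed.

(** Below order [k] the remainder grows like [|x|^(k - j)], exactly what the weight of [K_k] allows.
    From order [k] on only the dilated function is left: on its support [s (1 + |x|) <= 1 + A], so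
    the excess [s^(j - k)] cancels the weight up to a power of [1 + A], which is absorbed into the
    scale. *)
Lemma taylor_rem_kbdd k phi a A : 0 < a -> 1 <= A -> inD M c a `[- A, A] phi ->
  forall n, exists b, forall s, 0 < s -> s <= 1 ->
    kbdd M k (lev c ((1 + A) * a) n) (b * s ^+ k) (taylor_rem k phi s).
Proof.
move=> a0 A1 [sp p0 Hb] n; have [b0 Hb0] := Hb n.
have l0 := lev_gt0 c n a0; set l := lev c a n in Hb0 l0 *.
have A0 : 0 < 1 + A by lra.
rewrite levM -/l; clearbody l; set l' := (1 + A) * l.
have l0' : 0 < l' by rewrite mulr_gt0.
have W0 j : 0 < l' ^+ j * M j by rewrite mulr_gt0 ?exprn_gt0.
pose B := b0 * (l ^+ k * M k).
have B0 : 0 <= B by apply: le_trans (Hb0 k 0); exact: cabs_ge0.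
have b0_ge0 : 0 <= b0 by apply: weight_ge0 (Hb0 0%N 0) => //; exact: cabs_ge0.
pose F j := 2 ^+ k * B / (l' ^+ j * M j).
have F0 j : 0 <= F j by rewrite divr_ge0 ?(ltW (W0 _))// mulr_ge0 ?exprn_ge0.
exists (b0 + \sum_(j < k) F j) => s s0 s1 j x.
rewrite -rem_tower0 (tower_cderiven j (tower_rem k s sp)).
have x0 : 0 <= 1 + `|x| by rewrite addr_ge0.
have [jk|kj] := ltnP j k.
- have := rem_tower_low s0 sp (Hb0 k) (leq_subr j k) x.
  rewrite subKn ?(ltnW jk)// -/B => H.
  apply: le_trans (ler_wpM2l (exprn_ge0 j x0) H) _.
  have H1 : 2 ^+ k * B <= (b0 + \sum_(j < k) F j) * (l' ^+ j * M j).
    rewrite -ler_pdivrMr//; apply: le_trans (ler_sum_term F0 jk) _.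
    by rewrite lerDr.
  apply: le_trans (_ : (2 ^+ k * B) * s ^+ k * (1 + `|x|) ^+ k <= _); last first.
    rewrite [leRHS](_ : _ = (b0 + \sum_(j < k) F j) * (l' ^+ j * M j) *
      s ^+ k * (1 + `|x|) ^+ k); last by ring.
    by rewrite !ler_wpM2r// exprn_ge0// ltW.
  rewrite [leLHS](_ : _ = 2 ^+ (k - j) * (B * s ^+ k) *
    ((1 + `|x|) ^+ j * `|x| ^+ (k - j))); last by ring.
  rewrite (mulrA (2 ^+ (k - j))); apply: ler_pM.
  + by apply: mulr_ge0; [apply: mulr_ge0 => //; exact: exprn_ge0|rewrite exprn_ge0// ltW].
  + by apply: mulr_ge0; apply: exprn_ge0.
  + rewrite !ler_wpM2r ?exprn_ge0 ?(ltW s0)//.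
    by rewrite ler_weXn2l ?leq_subr// ler1n.
  + rewrite -[in leRHS](subnKC (ltnW jk)) exprD ler_wpM2l ?exprn_ge0//.
    by rewrite lerXn2r ?nnegrE// lerDr.
- rewrite rem_tower_high// cabsM cabs_real (gtr0_norm (exprn_gt0 _ s0)).
  have R0 : 0 <= (b0 + \sum_(j0 < k) F j0) * s ^+ k * (l' ^+ j * M j) * (1 + `|x|) ^+ k.
    rewrite !mulr_ge0 ?exprn_ge0 ?(ltW s0) ?(ltW l0') ?(ltW (M_gt0 j))//.
    by rewrite addr_ge0// sumr_ge0.
  have cA : closed (`[- A, A]%classic : set R) by exact: itv_closed.
  have [sx|sx] := leP `|s * x| A; last first.
    rewrite (cderiven_off _ sp cA p0) ?cabs0 ?mulr0//.
        by rewrite /= in_itv /= -ler_norml leNgt sx.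
  have xs : s * (1 + `|x|) <= 1 + A.
    by move: sx; rewrite normrM gtr0_norm// mulrDr mulr1; lra.
  rewrite -[in leLHS](subnK kj) !exprD.
  have H := Hb0 j (s * x).
  rewrite [leLHS](_ : _ = (s * (1 + `|x|)) ^+ (j - k) *
     cabs (cderiven j phi (s * x)) * (s ^+ k * (1 + `|x|) ^+ k)); last first.
    by rewrite exprMn subnK//; ring.
  rewrite [leRHS](_ : _ = (b0 + \sum_(j0 < k) F j0) * (l' ^+ j * M j) *
     (s ^+ k * (1 + `|x|) ^+ k)); last by ring.
  rewrite ler_wpM2r ?mulr_ge0 ?exprn_ge0 ?(ltW s0)//.
  apply: le_trans (_ : (1 + A) ^+ j * (b0 * (l ^+ j * M j)) <= _).
    apply: ler_pM => //; rewrite ?exprn_ge0 ?mulr_ge0 ?cabs_ge0 ?(ltW s0)//.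
    apply: le_trans (_ : (1 + A) ^+ (j - k) <= _).
      by rewrite lerXn2r ?nnegrE ?mulr_ge0 ?(ltW s0) ?(ltW A0).
    by rewrite ler_weXn2l ?leq_subr//; lra.
  have -> : (1 + A) ^+ j * (b0 * (l ^+ j * M j)) = b0 * (l' ^+ j * M j).
    by rewrite /l' exprMn; ring.
  apply: ler_wpM2r; first exact: ltW.
  by rewrite lerDl sumr_ge0.
Qed.

Lemma MAE_of_dual f g : lcs_dual (K_space c M) g ->
  (forall phi, lcs_carrier (D_space c M) phi -> f phi = g phi) ->
  satisfies_MAE (D_space c M) f.
Proof.
move=> gK fg; exists (fun m => g (monomial m)) => phi k Dphi.
have /D_carrier_itvP[A [a [A1 a0 Hphi]]] := Dphi.
have a0' : 0 < (1 + A) * a by rewrite mulr_gt0//; lra.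
have [n [B [B0 HB]]] := K_dual_bound M_gt0 k gK a0'.
have Hrem := taylor_rem_kbdd k a0 A1 Hphi.
have sphi : csmooth phi by case: Hphi.
have [b Hb] := Hrem n.
have remK s : 0 < s -> s <= 1 -> inK M c k ((1 + A) * a) (taylor_rem k phi s).
  move=> s0 s1; split; last by move=> j; have [b' Hb'] := Hrem j; exists (b' * s ^+ k); exact: Hb'.
  by rewrite -rem_tower0; exact: tower_csmooth (tower_rem k s sphi).
have monoC m : lcs_carrier (K_space c M) (monomial m).
  by apply/(K_carrierP c M_gt0); exists m, 1; split=> //; exact: inK_monomial.
(* [g] is linear only on the carrier, so the Taylor polynomial is added one monomial at a time with
   membership carried along; the remainder keeps order [k], and at [j = k] the sum is the dilated
   function itself. *)
have g_expand s j : 0 < s -> s <= 1 -> (j <= k)%N ->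
    lcs_carrier (K_space c M) (fun x =>
      taylor_rem k phi s x + \sum_(m < j) taylor_coef phi s m * monomial m x) /\
    g (fun x =>
      taylor_rem k phi s x + \sum_(m < j) taylor_coef phi s m * monomial m x) =
    g (taylor_rem k phi s) + \sum_(m < j) taylor_coef phi s m * g (monomial m).
  move=> s0 s1; elim: j => [_|j IH jk].
    rewrite big_ord0 addr0.
    have -> : (fun x => taylor_rem k phi s x +
        \sum_(m < 0) taylor_coef phi s m * monomial m x) = taylor_rem k phi s.
      by apply/funext => x; rewrite big_ord0 addr0.
    by split=> //; apply/(K_carrierP c M_gt0); exists k, ((1 + A) * a); split=> //; exact: remK.
  have [H1 H2] := IH (ltnW jk).
  set h := (fun x => _ + \sum_(m < j) _) in H1 H2.
  have -> : (fun x => taylor_rem k phi s x + \sum_(m < j.+1) taylor_coef phi s m * monomial m x) =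
      taylor_coef phi s j *: monomial j + h.
    apply/funext => x; rewrite big_ord_recr /= addrA addrC.
    by rewrite -[RHS]/(taylor_coef phi s j * monomial j x + h x).
  split; first exact: K_carrier_lin.
  by rewrite gK.1// H2 big_ord_recr /= addrCA (addrC (taylor_coef _ _ _ * _)).
have main l : 1 <= l -> cabs (dilated_pairing f l phi - \sum_(m < k)
     g (monomial m) * cderiven m phi 0 / ((m`!)%:R * (l ^+ m.+1)%:C)) <=
     B * (`|b| + 1) * (l ^+ k.+1)^-1.
  move=> l1; have l0 : 0 < l by lra.
  have s0 : 0 < l^-1 by rewrite invr_gt0.
  have s1 : l^-1 <= 1 by rewrite invf_le1.
  have E : dilated_pairing f l phi - \sum_(m < k)
     g (monomial m) * cderiven m phi 0 / ((m`!)%:R * (l ^+ m.+1)%:C) =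
     l^-1%:C * g (taylor_rem k phi l^-1).
    rewrite /dilated_pairing.
    have -> : (fun x => phi (x / l)) = dil l^-1 phi.
      by apply/funext => x; rewrite /dil mulrC.
    rewrite fg; last exact: D_carrier_dil.
    have [_] := g_expand _ k s0 s1 (leqnn k).
    rewrite (_ : (fun x => _) = dil l^-1 phi); last first.
      by apply/funext => x; rewrite /taylor_rem subrK.
    move=> ->; rewrite mulrDr -addrA -[RHS]addr0; congr (_ + _).
    apply/eqP; rewrite subr_eq0; apply/eqP; rewrite mulr_sumr.
    apply: eq_bigr => i _; rewrite /taylor_coef exprS rmorphM !invfM.
    rewrite !fmorphV !rmorphXn exprVn; ring.
  rewrite E cabsM cabs_real gtr0_norm//.
  have bs : 0 < (`|b| + 1) * l^-1 ^+ k.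
    by rewrite mulr_gt0 ?exprn_gt0// ltr_wpDl.
  have Kb : kbdd M k (lev c ((1 + A) * a) n) ((`|b| + 1) * l^-1 ^+ k) (taylor_rem k phi l^-1).
    apply: (kbddS M_gt0) (Hb _ s0 s1) => //; first exact: lev_gt0.
    rewrite ler_wpM2r ?exprn_ge0 ?(ltW s0)//.
    by apply: le_trans (ler_norm _) _; rewrite lerDl.
  have := HB _ _ bs (remK _ s0 s1) Kb.
  move=> /(ler_wpM2l (ltW s0)) H; apply: le_trans H _.
  by rewrite exprS invfM exprVn le_eqVlt; apply/orP; left; apply/eqP; ring.
apply/eqaddOP; near=> e.
exists 1; split => // l /ltW l1.
apply: le_trans (main l l1) _.
have il : 0 <= (l ^+ k.+1)^-1 by rewrite invr_ge0 exprn_ge0// (le_trans _ l1).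
rewrite (ger0_norm il); apply: ler_wpM2r => //; near: e; exact: nbhs_pinfty_ge.
Unshelve. all: by end_near. Qed.

End dilations.

(** * Cutoff functions *)

Section cutoff.
Context (R : realType) (M : nat -> R) (c : ultra_class).
Hypothesis M_gt0 : forall p, 0 < M p.
Hypothesis M1 : weight_M1 M.
Local Notation C := R[i].
Implicit Types (phi psi : R -> C) (K : set R).

(** Integrating from [-oo] gives a single formula at every point; vanishing outside a bounded set
    makes [h] integrable. *)
Lemma antiderivative (h : R -> R) (r : R) : continuous h ->
  (forall x, r < `|x| -> h x = 0) -> exists F : R -> R, forall x : R, is_derive x 1 F (h x).
Proof.
move=> ch h0.
have ih : (@lebesgue_measure R).-integrable [set: R] (EFin \o h).
  have ic := continuous_compact_integrable (@segment_compact R (- r) r)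
    (continuous_subspaceT ch).
  have := (@integrable_mkcond _ _ R (@lebesgue_measure R) `[- r, r]%classic
    (EFin \o h) (measurable_itv _)).1 ic.
  congr (_.-integrable _ _).
  apply/funext => x; rewrite patchE; case: ifPn => //.
  rewrite notin_setE /= in_itv /= -ler_norml => /negP; rewrite -ltNge => rx.
  by rewrite h0.
exists (fun x => (\int[lebesgue_measure]_(t in [set` `]-oo, x]]) h t)%R) => x.
have [||||dF F'] := @continuous_FTC1 R h -oo%O x (x + 1).
- by rewrite ltrDl.
- by apply: integrableS ih => //; exact: measurableT.
- by rewrite /= ltNyr.
- exact: ch.
- by split=> //; rewrite -F' derive1E.
Qed.

(* [chi] is built from a normalised antiderivative [Th 0] of [|phi0|^2]. *)
Lemma exists_cutoff phi0 x0 : lcs_carrier (D_space c M) phi0 -> phi0 x0 != 0 ->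
  exists chi h, [/\ csmooth chi, 0 < h,
    forall n, exists b, bdd M (lev c h n) b chi,
    forall x, `|x| <= 1 -> chi x = 1 & forall x, 2 <= `|x| -> chi x = 0].
Proof.
move=> /(D_carrier_itvP c M_gt0)[A [a [A1 a0 [sp p0 Hb]]]] phix0.
pose u m : R -> C := cderiven m phi0.
have tu : tower u by exact: csmooth_tower.
have cA : closed (`[- A, A]%classic : set R) by exact: itv_closed.
have u_off m x : A < `|x| -> u m x = 0.
  move=> Ax; apply: cderiven_off sp cA p0 _.
  by rewrite /= in_itv /= -ler_norml leNgt Ax.
pose v m x : C := (u m x)^*.
have tv : tower v by move=> m x; exact: cder_conj (tu m x).
have v_off m x : A < `|x| -> v m x = 0.
  by move=> Ax; rewrite /v u_off//; exact: conjc0.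
(* Multiplying by the conjugate gives a nonnegative function, hence a monotone antiderivative, at
   the price of doubling the scale. *)
pose W m := mul_tower u v m 0 0.
have tW : tower W by exact: tower_mul.
have W_off m x : A < `|x| -> W m x = 0.
  by move=> Ax; apply: mul_tower0 => i; exact: v_off.
have HW n : exists2 b, 0 <= b & forall m x, cabs (W m x) <= b * ((2 * lev c a n) ^+ m * M m).
  have [b H] := Hb n; have l0 := lev_gt0 c n a0.
  exists (b * b * M 0%N).
    by rewrite mulr_ge0 ?(ltW (M_gt0 _))// -expr2 sqr_ge0.
  move=> m x; have Hv i : cabs (v i x) <= b * (lev c a n ^+ i * M i).
    by rewrite cabs_conj; exact: H.
  have := mul_tower_le m 0 0 M_gt0 M1 l0 l0 (H ^~ x) Hv.
  by rewrite !expr0 !mulr1 !addn0 mulr_natl mulr2n.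
pose w x : R := complex.Re (W 0%N x).
have wE x : W 0%N x = (w x)%:C.
  rewrite /w /W /= /v /u /cderiven /=; case: (phi0 x) => p q /=; apply/eqP.
  by rewrite eq_complex /= eqxx /=; apply/eqP; ring.
have w0 x : 0 <= w x.
  rewrite /w /W /= /v /u /cderiven /=; case: (phi0 x) => p q /=.
  by rewrite mulrN opprK -!expr2 addr_ge0 ?sqr_ge0.
have wx0 : w x0 != 0.
  apply: contra phix0 => /eqP wx; have := wE x0; rewrite wx => H.
  have : cabs (u 0%N x0 * v 0%N x0) = 0 by rewrite -[u _ _ * _]/(W 0%N x0) H cabs0.
  rewrite cabsM cabs_conj => /eqP; rewrite mulf_eq0 orbb => /eqP.
  by move=> /cabs0_eq0 e0; apply/eqP; exact: e0.
have w_off x : A < `|x| -> w x = 0 by move=> Ax; rewrite /w W_off.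
have cw : continuous w by move=> x; exact: is_derive_continuous (tW 0%N x).1.
have [F dF] := antiderivative cw w_off.
have cF (p q : R) : {within `[p, q], continuous F}.
  by apply: continuous_subspaceT => y; exact: is_derive_continuous (dF y).
have Fmono x y : x <= y -> F x <= F y.
  move=> xy; have [z _] := MVT_segment xy (fun z _ => dF z) (cF _ _).
  by move=> E; rewrite -subr_ge0 E mulr_ge0// subr_ge0.
(* The margin 1 keeps the mean value points, which may be endpoints, strictly outside [[-A, A]], and
   [x0] strictly between [-r] and [r]. *)
pose r := A + 1.
have Fr x : r <= x -> F x = F r.
  move=> rx; have [z] := MVT_segment rx (fun z _ => dF z) (cF _ _).
  rewrite in_itv /= => /andP[rz _]; rewrite w_off ?mul0r.
    by move=> /eqP; rewrite subr_eq0 => /eqP.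
  by rewrite ger0_norm; move: rz; rewrite /r; lra.
have FNr x : x <= - r -> F x = F (- r).
  move=> rx; have [z] := MVT_segment rx (fun z _ => dF z) (cF _ _).
  rewrite in_itv /= => /andP[_ rz]; rewrite w_off ?mul0r.
    by move=> /eqP; rewrite subr_eq0 => /eqP.
  by rewrite ler0_norm; move: rz; rewrite /r; lra.
have x0A : `|x0| <= A.
  by rewrite leNgt; apply: contra wx0 => /w_off ->.
pose De := F r - F (- r).
(* Without any increase the monotone [F] would be constant near [x0], and its derivative [w x0]
   would vanish. *)
have De0 : 0 < De.
  rewrite subr_gt0 lt_neqAle Fmono ?andbT; last by rewrite /r; lra.
  apply: contra wx0 => /eqP FF.
  have : (w x0)%:C = 0 :> C.
    apply: (@cder_near0 _ (fun y => (F y - F (- r))%:C) x0); last first.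
      apply: cder_real; have := is_deriveB (dF x0) (is_derive_cst (F (- r)) x0 1).
      by apply: is_derive_ext_val => //; rewrite subr0.
    have [l1 l2] : - r < x0 /\ x0 < r.
      by move: x0A; rewrite ler_norml /r => /andP[]; lra.
    near=> y.
    have yr : y <= r by near: y; exact: lt_le_nbhsl.
    have ry : - r <= y by near: y; exact: lt_le_nbhsr.
    have := Fmono _ _ yr; have := Fmono _ _ ry; rewrite -FF => e1 e2.
    by rewrite (_ : F y = F (- r)) ?subrr//; apply/eqP; rewrite eq_le e1 e2.
  by move=> [->].
pose Th m : R -> C := if m is m'.+1 then fun x => De^-1%:C * W m' x
  else fun x => ((F x - F (- r)) / De)%:C.
have tTh : tower Th.
  move=> [|m] x /=; last exact: cderZ (tW m x).
  rewrite wE -rmorphM; apply: cder_real.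
  have := is_deriveZ De^-1 (is_deriveB (dF x) (is_derive_cst (F (- r)) x 1)).
  by apply: is_derive_ext_val => [y|]; rewrite ?subr0// /GRing.scale /= mulrC.
have Th1 x : r <= x -> Th 0%N x = 1.
  by move=> rx; rewrite /Th Fr// divff ?gt_eqF.
have Th0 x : x <= - r -> Th 0%N x = 0.
  by move=> rx; rewrite /Th FNr// subrr mul0r.
have Th_le1 x : cabs (Th 0%N x) <= 1.
  rewrite /Th cabs_real ger0_norm.
    rewrite ler_pdivrMr// mul1r /De lerD2r.
    have [/Fmono//|/ltW /Fr -> //] := leP x r.
  rewrite divr_ge0 ?(ltW De0)// subr_ge0.
  by have [/Fmono//|/ltW /FNr -> //] := leP (- r) x.
have HTh n : exists2 b, 0 <= b & forall m x, cabs (Th m x) <= b * ((2 * lev c a n) ^+ m * M m).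
  have [b b0 H] := HW n; set L := 2 * lev c a n in H *.
  have L0 : 0 < L by rewrite mulr_gt0// lev_gt0.
  (* Integration shifts orders by one, so [Th m.+1] is controlled by [M m]. Log-convexity in the
     form [M 1 * M m <= M 0 * M m.+1] converts this to [M m.+1] and dictates the constant. *)
  pose k := De^-1 * b * M 0%N / (M 1%N * L).
  have k0 : 0 <= k.
    apply: divr_ge0; last by apply: mulr_ge0; exact: ltW.
    by apply: mulr_ge0; [apply: mulr_ge0 => //; rewrite invr_ge0|]; exact: ltW.
  have i0 : 0 <= (M 0%N)^-1 by rewrite invr_ge0 ltW.
  exists (k + (M 0%N)^-1); first exact: addr_ge0.
  move=> [|m] x.
    apply: le_trans (Th_le1 x) _; rewrite expr0 mul1r mulrDl mulVf ?gt_eqF//.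
    by rewrite lerDr mulr_ge0// ltW.
  rewrite /Th cabsM cabs_real gtr0_norm ?invr_gt0//.
  apply: le_trans (ler_wpM2l _ (H m x)) _; first by rewrite invr_ge0 ltW.
  apply: le_trans (_ : k * (L ^+ m.+1 * M m.+1) <= _); last first.
    by rewrite ler_wpM2r ?lerDl// mulr_ge0 ?exprn_ge0 ?(ltW L0)// ltW.
  have := weight_ratio M_gt0 M1 (leq0n m) => Hr.
  have -> : k * (L ^+ m.+1 * M m.+1) = De^-1 * b * L ^+ m / M 1%N * (M 0%N * M m.+1).
    by rewrite /k exprS; field; rewrite !gt_eqF.
  have -> : De^-1 * (b * (L ^+ m * M m)) = De^-1 * b * L ^+ m / M 1%N * (M 1%N * M m).
    by field; rewrite !gt_eqF.
  apply: ler_wpM2l => //.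
  apply: divr_ge0; last exact: ltW.
  apply: mulr_ge0; last by apply: exprn_ge0; exact: ltW.
  by apply: mulr_ge0 => //; rewrite invr_ge0 ltW.
(* [s * x + t] goes from [-r] at [x = 1] to [r] at [x = 2], so the rescaled [Th 0] climbs from 0 to
   1 on [[1, 2]]. The cutoff is 1 minus this function and its mirror image; [(m == 0)%:R] is the
   tower of the constant 1. *)
pose s := 2 * r; pose t := - (3 * r).
have r0 : 0 < r by rewrite /r; lra.
have s0 : 0 < s by rewrite mulr_gt0.
pose X m x : C := (m == 0%N)%:R
  - ((s ^+ m)%:C * Th m (s * x + t) + ((- s) ^+ m)%:C * Th m (- s * x + t)).
have tX : tower X.
  move=> m x.
  have t1 := tower_affine s t tTh m x; have t2 := tower_affine (- s) t tTh m x.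
  have := cderD (cder_cst (m == 0%N)%:R x) (cderZ (-1) (cderD t1 t2)).
  by apply: cder_ext => [y|]; rewrite /X mulN1r// add0r.
have sX : csmooth (X 0%N) by exact: tower_csmooth.
exists (X 0%N), (s * (2 * a)); split => //.
- by rewrite !mulr_gt0.
- move=> n; have [b b0 H] := HTh n; set L := 2 * lev c a n in H.
  have L0 : 0 < L by rewrite mulr_gt0// lev_gt0.
  exists ((M 0%N)^-1 + 2 * b) => m x; rewrite (tower_cderiven m tX) 2!levM -/L.
  have H1 : cabs (m == 0%N)%:R <= (M 0%N)^-1 * ((s * L) ^+ m * M m).
    case: m => [|m] /=; first by rewrite cabs1 expr0 mul1r mulVf ?gt_eqF.
    rewrite cabs0; apply: mulr_ge0; first by rewrite invr_ge0 ltW.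
    by rewrite mulr_ge0 ?exprn_ge0 ?(ltW (M_gt0 _))// mulr_ge0// ltW.
  have H2 y : cabs ((s ^+ m)%:C * Th m y) <= b * ((s * L) ^+ m * M m).
    rewrite cabsM cabs_real gtr0_norm ?exprn_gt0//.
    have -> : b * ((s * L) ^+ m * M m) = s ^+ m * (b * (L ^+ m * M m)).
      by rewrite exprMn; ring.
    by rewrite ler_wpM2l// exprn_ge0// ltW.
  have H3 y : cabs (((- s) ^+ m)%:C * Th m y) <= b * ((s * L) ^+ m * M m).
    apply: le_trans (H2 y); rewrite !cabsM !cabs_real !normrX normrN.
    exact: lexx.
  apply: le_trans (cabs_triangleB _ _) _; rewrite mulrDl lerD//.
  apply: le_trans (cabs_triangle _ _) _.
  by have := H2 (s * x + t); have := H3 (- s * x + t); lra.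
- move=> x; rewrite ler_norml => /andP[x1 x2]; rewrite /X !expr0 !mul1r.
  rewrite !Th0 ?addr0 ?subr0//; rewrite /s /t; nra.
- move=> x; rewrite /X !expr0 !mul1r; have [x0'|x0'] := leP 0 x.
    rewrite ger0_norm// => x2.
    by rewrite Th1 ?Th0 ?addr0 ?subrr// /s /t; nra.
  rewrite ltr0_norm// => x2.
  by rewrite Th0 ?Th1 ?add0r ?subrr// /s /t; nra.
Unshelve. all: by end_near. Qed.

End cutoff.

(** * Extension of a functional with a moment expansion *)

Section moment_expansion.
Context (R : realType) (M : nat -> R) (c : ultra_class).
Hypothesis M_gt0 : forall p, 0 < M p.
Hypothesis M1 : weight_M1 M.
Local Notation C := R[i].
Implicit Types (phi psi chi : R -> C) (K : set R).

Definition fmul psi chi : R -> C := fun x => psi x * chi x.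

(** A factor vanishing off [K] makes the other one matter only on [K]; this is how functions growing
    at infinity are turned into test functions. *)
Lemma bdd_fmul K psi chi (l b l' b' : R) : closed K -> 0 < l -> 0 < l' ->
  csmooth psi -> csmooth chi -> (forall x, ~ K x -> chi x = 0) ->
  bdd_on M K l b psi -> bdd M l' b' chi ->
  0 <= b -> 0 <= b' ->
  csmooth (fmul psi chi) /\ bdd M (l + l') (b * b' * M 0%N) (fmul psi chi).
Proof.
move=> cK l0 l0' sp sq q0 Hp Hq b0 b0'.
have tp := csmooth_tower sp; have tq := csmooth_tower sq.
have tw := tower_mul 0 0 tp tq; split; first exact: tower_csmooth tw.
move=> m x; rewrite (tower_cderiven m tw).
have [Kx|Kx] := pselect (K x).
  have := mul_tower_le m 0 0 M_gt0 M1 l0 l0' (fun i => Hp i x Kx) (fun i => Hq i x).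
  by rewrite !expr0 !mulr1 !addn0.
rewrite mul_tower0 => [|i]; last exact: cderiven_off sq cK q0 Kx.
rewrite cabs0; apply: mulr_ge0.
  by apply: mulr_ge0; [exact: mulr_ge0|exact: ltW].
by apply: mulr_ge0; [apply: exprn_ge0; rewrite addr_ge0 ?ltW|exact: ltW].
Qed.

Definition annulus : set R := `[- 2, - 2^-1]%classic `|` `[2^-1, 2]%classic.

Lemma annulusP x : annulus x <-> 2^-1 <= `|x| <= 2.
Proof.
rewrite /annulus /= !in_itv /=; split.
  by move=> [/andP[x1 x2]|/andP[x1 x2]]; [rewrite ler0_norm|rewrite ger0_norm]; lra.
have [x0|x0] := leP 0 x; first by rewrite ger0_norm//; right.
by rewrite ltr0_norm// => /andP[x1 x2]; left; lra.
Qed.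

Lemma compact_annulus : compact annulus.
Proof. by apply: compactU; exact: segment_compact. Qed.

Lemma dil_lin s (z : C) phi psi :
  dil s (z *: phi + psi) = z *: dil s phi + dil s psi.
Proof. by []. Qed.

(** Every term of the expansion carries a derivative at 0, so only the error is left; the prefactor
    of the dilated pairing accounts for the drop from [k + 1] to [k]. *)
Lemma MAE_bound f phi k : satisfies_MAE (D_space c M) f ->
  lcs_carrier (D_space c M) phi -> (forall m, cderiven m phi 0 = 0 :> C) ->
  exists B L : R, forall l, L < l -> 0 < l ->
    cabs (f (dil l^-1 phi)) <= B / l ^+ k.
Proof.
move=> [mu Hmu] Dphi p0.
have /eqaddOP [B [_ HB]] := Hmu phi k Dphi.
have [|L [_ HL]] := HB (B + 1); first by rewrite ltrDl.
exists (B + 1), L => l Ll l0.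
have : cabs (dilated_pairing f l phi - \sum_(m < k)
    mu m * cderiven m phi 0 / ((m`!)%:R * (l ^+ m.+1)%:C)) <=
    (B + 1) * `|(l ^+ k.+1)^-1| by exact: HL.
rewrite big1 ?subr0; last by move=> i _; rewrite p0 mulr0 mul0r.
have -> : dilated_pairing f l phi = l^-1%:C * f (dil l^-1 phi).
  by congr (_ * f _); apply/funext => x; rewrite /dil mulrC.
have il : 0 < (l ^+ k.+1)^-1 by rewrite invr_gt0 exprn_gt0.
rewrite (gtr0_norm il) cabsM cabs_real gtr0_norm ?invr_gt0//.
by rewrite exprS invfM mulrCA ler_pM2l ?invr_gt0.
Qed.

Lemma annulus_decay f (k : nat) (a : R) : 0 < a ->
  lcs_dual (D_space c M) f -> satisfies_MAE (D_space c M) f ->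
  exists n (B : R), 0 < B /\ forall j phi b, 0 < b -> inD M c a annulus phi ->
    bdd M (lev c a n) b phi ->
    cabs (f (dil (2 ^+ j)^-1 phi)) <= B * b / (2 ^+ j) ^+ k.
Proof.
move=> a0 fD fMAE.
have s0 j : 0 < (2 : R) ^+ j by rewrite exprn_gt0.
pose T j phi := ((2 ^+ j) ^+ k : R)%:C * f (dil (2 ^+ j)^-1 phi).
have cabsT j phi : cabs (T j phi) = (2 ^+ j) ^+ k * cabs (f (dil (2 ^+ j)^-1 phi)).
  by rewrite cabsM cabs_real gtr0_norm ?exprn_gt0.
have off0 : ~ annulus 0.
  by move=> /annulusP; rewrite normr0 => /andP[]; lra.
have D_ann phi : inD M c a annulus phi -> lcs_carrier (D_space c M) phi.
  move=> Hp; apply/(D_carrierP c M_gt0); exists annulus, a; split=> //.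
  exact: compact_annulus.
have D_seg phi : inD M c a annulus phi -> inD M c a `[- 2, 2] phi.
  move=> [sp p0 Hb]; split=> // x Hx; apply: p0 => /annulusP /andP[_ x2].
  by apply: Hx; rewrite /= in_itv /= -ler_norml.
have DT j phi : inD M c a annulus phi ->
    lcs_carrier (D_space c M) (dil (2 ^+ j)^-1 phi).
  by move=> Hp; apply: D_carrier_dil; rewrite ?invr_gt0//; exact: D_ann.
have Tlin j (z : C) phi psi : inD M c a annulus phi -> inD M c a annulus psi ->
    T j (z *: phi + psi) = z * T j phi + T j psi.
  move=> Hp Hq; rewrite /T dil_lin fD.1 ?mulrDr; try exact: DT.
  by congr (_ + _); ring.
have [n [B HB]] : exists n B, forall j phi, inD M c a annulus phi ->
    bdd M (lev c a n) 1 phi -> cabs (T j phi) <= B.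
  apply: uniform_boundedness => //.
  - move=> j; have i0 : 0 < ((2 : R) ^+ j)^-1 by rewrite invr_gt0.
    have a0' : 0 < (2 ^+ j)^-1 * a by rewrite mulr_gt0.
    have [n [B [B0 HB]]] := D_dual_bound M_gt0 fD
      (@segment_compact R (- (2 / (2 ^+ j)^-1)) (2 / (2 ^+ j)^-1)) a0'.
    exists n, ((2 ^+ j) ^+ k * (B * 1)) => phi Hp bp.
    rewrite cabsT ler_wpM2l ?exprn_ge0//; apply: HB => //.
      by apply: inD_dil => //; exact: D_seg.
    by rewrite levM; apply: bdd_dil => //; case: Hp.
  - move=> phi Hp; have := Hp => -[sp p0 _].
    have cAnn : closed annulus by apply: compact_closed => //; exact: compact_annulus.
    have [B [L HL]] := MAE_bound k fMAE (D_ann _ Hp)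
      (fun m => cderiven_off m sp cAnn p0 off0).
    have [N HN] : exists N : nat, L < 2 ^+ N.
      exists (Num.truncn L).+1; apply: lt_trans (truncnS_gt _) _.
      by rewrite -natrX ltr_nat; exact: ltn_expl.
    (* The expansion controls only large [j]; the sum covers the finitely many others, and [|B|]
       compensates for a possibly negative [B]. *)
    exists (B + \sum_(j < N) cabs (T j phi) + `|B|) => j.
    have S0 : 0 <= \sum_(j < N) cabs (T j phi) by apply: sumr_ge0 => i _; exact: cabs_ge0.
    have [jN|Nj] := ltnP j N.
      have := ler_sum_term (F := fun j => cabs (T j phi)) (fun i => cabs_ge0 _) jN.
      by have := ler_norm (- B); rewrite normrN; lra.
    have := HL (2 ^+ j) _ (s0 j).
    rewrite ler_pdivlMr ?exprn_gt0// mulrC -cabsT => H.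
    apply: le_trans (H _) _; last by have := normr_ge0 B; lra.
    by apply: lt_le_trans HN _; rewrite ler_weXn2l// ler1n.
exists n, (`|B| + 1); split; first by rewrite ltr_wpDl.
move=> j phi b b0 Hp bp.
have K1 : bdd M (lev c a n) 1 (b^-1%:C *: phi).
  have := bdd_scale b^-1%:C M_gt0 (lev_gt0 c n a0) _ bp.
  rewrite cabs_real gtr0_norm ?invr_gt0// mulVf ?gt_eqF//.
  by apply; case: Hp.
have := HB j _ (inD_scale b^-1%:C M_gt0 a0 Hp) K1.
have T0 : T j 0 = 0.
  exact: eq0_lin0 (Tlin j 1 0 0 (inD0 c annulus M_gt0 a0) (inD0 c annulus M_gt0 a0)).
rewrite -[_ *: _]addr0 Tlin//; last exact: inD0.
rewrite T0 addr0 cabsM cabs_real gtr0_norm ?invr_gt0// mulrC ler_pdivrMr//.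
rewrite cabsT => H; rewrite ler_pdivlMr ?exprn_gt0// mulrC.
apply: le_trans H _; rewrite ler_wpM2r ?(ltW b0)//.
by apply: le_trans (ler_norm _) _; rewrite lerDl.
Qed.

(** Near 0 the weight is no help against [s^m], so the scale grows with [s]. This suffices for each
    truncation to be a test function, but not for estimates uniform in the dilation. *)
Lemma kbdd_dil q (l b s : R) psi : 0 < l -> 0 <= b -> 1 <= s ->
  csmooth psi -> kbdd M q l b psi ->
  bdd_on M `[- 2, 2] (s * l) (b * (1 + 2 * s) ^+ q) (dil s psi).
Proof.
move=> l0 b0 s1 sp H m x; rewrite /= in_itv /= -ler_norml => x2.
have [_ ->] := csmooth_dil s sp; have s0 : 0 < s by lra.
rewrite cabsM cabs_real (gtr0_norm (exprn_gt0 _ s0)) exprMn.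
have x0 : 1 <= 1 + `|s * x| by rewrite lerDl.
have H1 : cabs (cderiven m psi (s * x)) <= b * (l ^+ m * M m) * (1 + 2 * s) ^+ q.
  apply: le_trans (_ : (1 + `|s * x|) ^+ m * cabs (cderiven m psi (s * x)) <= _).
    by rewrite ler_peMl ?cabs_ge0// exprn_ege1.
  apply: le_trans (H m _) _; rewrite ler_wpM2l//.
    by rewrite !mulr_ge0 ?exprn_ge0 ?(ltW l0) ?(ltW (M_gt0 _)).
  have y2 : 1 + `|s * x| <= 1 + 2 * s by rewrite normrM (gtr0_norm s0); nra.
  by rewrite lerXn2r ?nnegrE//; lra.
rewrite [leRHS](_ : _ = s ^+ m * (b * (l ^+ m * M m) * (1 + 2 * s) ^+ q)); last by ring.
by rewrite ler_wpM2l// exprn_ge0// ltW.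
Qed.

(** On the annulus [y = 1 + |s x|] satisfies [s <= 2 y] and [y <= 3 s]. The first inequality lets
    the weight absorb [s^m], leaving the scale [2 * l] free of [s]; the second leaves only the
    growth factor [s^q]. *)
Lemma kbdd_dil_annulus q (l b s : R) psi : 0 < l -> 0 <= b -> 1 <= s ->
  csmooth psi -> kbdd M q l b psi ->
  bdd_on M annulus (2 * l) (b * 3 ^+ q * s ^+ q) (dil s psi).
Proof.
move=> l0 b0 s1 sp H m x /annulusP /andP[x1 x2].
have [_ ->] := csmooth_dil s sp; have s0 : 0 < s by lra.
rewrite cabsM cabs_real (gtr0_norm (exprn_gt0 _ s0)) exprMn.
set y := 1 + `|s * x|.
have yE : y = 1 + s * `|x| by rewrite /y normrM (gtr0_norm s0).
have y0 : 0 < y by rewrite yE; nra.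
have sy : s <= 2 * y by rewrite yE; nra.
have ys : y <= 3 * s by rewrite yE; nra.
have W0 : 0 <= l ^+ m * M m by rewrite mulr_ge0 ?exprn_ge0 ?(ltW l0)// ltW.
apply: le_trans (_ : (2 * y) ^+ m * cabs (cderiven m psi (s * x)) <= _).
  rewrite ler_wpM2r ?cabs_ge0// lerXn2r ?nnegrE//; lra.
apply: le_trans (_ : 2 ^+ m * (b * (l ^+ m * M m) * y ^+ q) <= _).
  by rewrite exprMn -(mulrA (2 ^+ m)); apply: ler_wpM2l; [exact: exprn_ge0|exact: H].
rewrite [leRHS](_ : _ = 2 ^+ m * (b * (l ^+ m * M m) * (3 * s) ^+ q)); last first.
  by rewrite exprMn; ring.
apply: ler_wpM2l; first exact: exprn_ge0.
apply: ler_wpM2l; first exact: mulr_ge0.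
by rewrite lerXn2r ?nnegrE//; lra.
Qed.

End moment_expansion.

(** * Limits along dyadic truncations *)

Section extension.
Context (R : realType) (M : nat -> R) (c : ultra_class).
Hypothesis M_gt0 : forall p, 0 < M p.
Hypothesis M1 : weight_M1 M.
Local Notation C := R[i].
Implicit Types (phi psi : R -> C).

(** Convergence with an explicit geometric rate, so that uniqueness and linearity of limits are
    plain inequalities. *)
Definition halving_lim (z : nat -> C) (w : C) : Prop :=
  exists B : R, forall j, cabs (w - z j) <= B / 2 ^+ j.

Lemma halving_lim_uniq z w w' : halving_lim z w -> halving_lim z w' -> w = w'.
Proof.
move=> [B HB] [B' HB']; apply/eqP; rewrite -subr_eq0; apply/eqP/cabs0_eq0.
apply/eqP; rewrite eq_le cabs_ge0 andbT.
apply: (@le_add_halving _ _ _ (B + B')) => j; rewrite add0r mulrDl.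
apply: le_trans (cabs_via (z j) _ _) _; apply: lerD => //.
by rewrite cabs_distC.
Qed.

Lemma halving_lim_lin (a : C) z z' w w' : halving_lim z w -> halving_lim z' w' ->
  halving_lim (fun j => a * z j + z' j) (a * w + w').
Proof.
move=> [B HB] [B' HB']; exists (cabs a * B + B') => j.
rewrite (_ : _ - _ = a * (w - z j) + (w' - z' j)); last by ring.
apply: le_trans (cabs_triangle _ _) _; rewrite mulrDl lerD// cabsM -mulrA.
by rewrite ler_wpM2l ?cabs_ge0.
Qed.

Lemma halving_lim_eventually z w N : (forall j, (N <= j)%N -> z j = w) ->
  halving_lim z w.
Proof.
move=> H; exists ((\sum_(j < N) cabs (w - z j)) * 2 ^+ N) => j.
have S0 : 0 <= \sum_(j < N) cabs (w - z j) by apply: sumr_ge0 => i _; exact: cabs_ge0.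
have [jN|Nj] := ltnP j N; last first.
  by rewrite H// subrr cabs0 divr_ge0 ?mulr_ge0 ?exprn_ge0.
have H1 := ler_sum_term (F := fun j => cabs (w - z j)) (fun i => cabs_ge0 _) jN.
apply: le_trans H1 _.
rewrite -mulrA ler_peMr// ler_pdivlMr ?exprn_gt0// mul1r.
by rewrite ler_weXn2l ?ler1n// ltnW.
Qed.

Lemma in_dual_of_cutoff f chi h : lcs_dual (D_space c M) f ->
  satisfies_MAE (D_space c M) f -> csmooth chi -> 0 < h ->
  (forall n, exists b, bdd M (lev c h n) b chi) ->
  (forall x, `|x| <= 1 -> chi x = 1) -> (forall x, 2 <= `|x| -> chi x = 0) ->
  in_dual_of (K_space c M) (D_space c M) f.
Proof.
move=> fD fMAE schi h0 Hchi chi1 chi0.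
have s_gt0 j : 0 < (2 : R) ^+ j by rewrite exprn_gt0.
have s_ge1 j : 1 <= (2 : R) ^+ j by rewrite exprn_ege1// ler1n.
have cseg : closed (`[- 2, 2]%classic : set R) by exact: itv_closed.
have chi_off x : ~ `[- 2, 2]%classic x -> chi x = 0.
  rewrite /= in_itv /= -ler_norml => /negP; rewrite -ltNge => /ltW; exact: chi0.
have Hchi' n : exists2 b, 0 <= b & bdd M (lev c h n) b chi.
  have [b Hb] := Hchi n; exists b => //.
  by apply: (weight_ge0 M_gt0 (lev_gt0 c n h0) (cabs_ge0 _) (Hb 0%N 0)).
have kbdd_ge0 q (l b : R) psi : 0 < l -> kbdd M q l b psi -> 0 <= b.
  move=> l0 H; apply: (weight_ge0 M_gt0 l0 (cabs_ge0 (cderiven 0 psi 0)) (m := 0%N)).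
  by have := H 0%N 0; rewrite normr0 addr0 !expr1n mul1r mulr1.
(* The truncation [P j psi] introduced below, dilated back to the fixed support [[-2, 2]]. *)
pose Q j psi := fmul (dil (2 ^+ j) psi) chi.
have Qbdd j q a n b b' psi : 0 < a -> csmooth psi -> kbdd M q (lev c a n) b psi ->
    bdd M (lev c h n) b' chi -> 0 <= b' ->
    csmooth (Q j psi) /\ bdd M (lev c (2 ^+ j * a + h) n)
      (b * (1 + 2 * 2 ^+ j) ^+ q * b' * M 0%N) (Q j psi).
  move=> a0 sp Hp Hb' b'0; have l0 := lev_gt0 c n a0.
  have b0 := kbdd_ge0 _ _ _ _ l0 Hp.
  rewrite levD levM; apply: (bdd_fmul M_gt0 M1 cseg) => //.
  - by rewrite mulr_gt0.
  - exact: lev_gt0.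
  - by case: (csmooth_dil (2 ^+ j) sp).
  - exact: kbdd_dil.
  - by rewrite mulr_ge0// exprn_ge0// addr_ge0// mulr_ge0// ltW.
have QD j q a psi : 0 < a -> inK M c q a psi ->
    inD M c (2 ^+ j * a + h) `[- 2, 2]%classic (Q j psi).
  move=> a0 [sp Hp]; split.
  - have [b Hb] := Hp 0%N; have [b' b'0 Hb'] := Hchi' 0%N.
    by case: (Qbdd j q a 0%N b b' psi).
  - by move=> x /chi_off Hx; rewrite /Q /fmul Hx mulr0.
  - move=> n; have [b Hb] := Hp n; have [b' b'0 Hb'] := Hchi' n.
    by exists (b * (1 + 2 * 2 ^+ j) ^+ q * b' * M 0%N); case: (Qbdd j q a n b b' psi).
pose P j psi : R -> C := fun x => psi x * chi ((2 ^+ j)^-1 * x).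
have PQ j psi : P j psi = dil (2 ^+ j)^-1 (Q j psi).
  by apply/funext => x; rewrite /P /dil /Q /fmul /dil mulrA divff ?gt_eqF// mul1r.
have PD j psi : lcs_carrier (K_space c M) psi -> lcs_carrier (D_space c M) (P j psi).
  move=> /(K_carrierP c M_gt0)[q [a [a0 Hp]]]; rewrite PQ.
  apply: D_carrier_dil; rewrite ?invr_gt0//.
  apply/(D_carrierP c M_gt0); exists `[- 2, 2]%classic, (2 ^+ j * a + h); split.
  - exact: segment_compact.
  - by rewrite addr_gt0// mulr_gt0.
  - exact: QD Hp.
have fPlin j (z : C) phi psi : lcs_carrier (K_space c M) phi ->
    lcs_carrier (K_space c M) psi ->
    f (P j (z *: phi + psi)) = z * f (P j phi) + f (P j psi).
  move=> Hp Hq; rewrite -fD.1; [|exact: PD|exact: PD].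
  congr f; apply/funext => x.
  by rewrite -[RHS]/(z * P j phi x + P j psi x) /P -[(_ + _) x]/(z * phi x + psi x); ring.
pose eta : R -> C := chi - dil 2 chi.
have [sdil _] := csmooth_dil 2 schi.
have chi1E : eta = (-1) *: dil 2 chi + chi by rewrite scaleN1r addrC.
have schi1 : csmooth eta by rewrite chi1E; case: (csmooth_lin (-1) sdil schi).
have chi1_off x : ~ annulus x -> eta x = 0.
  move=> Hx; rewrite -[eta x]/(chi x - chi (2 * x)).
  have [x2|x2] := leP 2 `|x|.
    rewrite chi0// chi0 ?subrr// normrM ger0_norm//; lra.
  have x1 : `|x| < 2^-1.
    by rewrite ltNge; apply/negP => x1; apply: Hx; apply/annulusP; rewrite x1 ltW.
  rewrite chi1 ?chi1 ?subrr//; last lra.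
  rewrite normrM ger0_norm//; lra.
have Hchi1 n : exists2 b, 0 <= b & bdd M (lev c (2 * h) n) b eta.
  have [b b0 Hb] := Hchi' n; have l0 := lev_gt0 c n h0.
  exists (cabs (-1) * b + b); first by rewrite addr_ge0// mulr_ge0// cabs_ge0.
  rewrite chi1E levM; apply: bdd_lin => //; first exact: bdd_dil.
  apply: bdd_le Hb => //; lra.
have cAnn : closed (@annulus R) by apply: compact_closed => //; exact: compact_annulus.
have Pdiff j psi : P j.+1 psi - P j psi =
    dil (2 ^+ j.+1)^-1 (fmul (dil (2 ^+ j.+1) psi) eta).
  apply/funext => x; rewrite -[LHS]/(P j.+1 psi x - P j psi x) /P.
  rewrite /dil /fmul mulrA divff ?gt_eqF// mul1r.
  rewrite -[eta _]/(chi _ - chi (2 * _)) mulrBr; congr (_ - _ * chi _).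
  by rewrite exprS invfM !mulrA divff// mul1r.
have key q a : 0 < a -> exists n B, forall b psi, 0 < b -> inK M c q a psi ->
    kbdd M q (lev c a n) b psi -> cabs (f (P 0 psi)) <= B * b /\
    forall j, cabs (f (P j.+1 psi) - f (P j psi)) <= B * b / 2 ^+ j.
  move=> a0.
  have a1 : 0 < 2 ^+ 0 * a + h by rewrite addr_gt0// mulr_gt0.
  have a2 : 0 < 2 * a + 2 * h by rewrite addr_gt0// mulr_gt0.
  have [n1 [B1 [B10 HB1]]] := D_dual_bound M_gt0 fD (@segment_compact R (- 2) 2) a1.
  have [n2 [B2 [B20 HB2]]] := annulus_decay M_gt0 q.+1 a2 fD fMAE.
  have [b1 b10 Hb1] := Hchi' n1; have [b2 b20 Hb2] := Hchi1 n2.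
  (* [k1] and [k2] collect the constants of the product estimates for the first truncation and for
     the annular pieces, without the factor [(2 ^+ j.+1) ^+ q]; adding 1 to [b1] and [b2] keeps them
     positive. *)
  pose k1 := (1 + 2 * 2 ^+ 0) ^+ q * (b1 + 1) * M 0%N.
  pose k2 := 3 ^+ q * (b2 + 1) * M 0%N.
  have k10 : 0 < k1 by rewrite !mulr_gt0// ?exprn_gt0// ltr_pwDr.
  have k20 : 0 < k2 by rewrite !mulr_gt0// ?exprn_gt0// ltr_pwDr.
  exists (maxn n1 n2), (B1 * k1 + B2 * k2) => b psi b0 Hpsi Hb.
  have spsi : csmooth psi by case: Hpsi.
  have Hbi n : (n <= maxn n1 n2)%N -> kbdd M q (lev c a n) b psi.
    move=> nm; apply: (kbddS M_gt0) Hb => //; first exact: lev_gt0.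
    exact: lev_le.
  have K1 := Hbi n1 (leq_maxl _ _); have K2 := Hbi n2 (leq_maxr _ _).
  split=> [|j].
    have P0 : P 0%N psi = Q 0%N psi.
      by apply/funext => x; rewrite /P /Q /fmul /dil expr0 invr1 mul1r.
    have Hb1' : bdd M (lev c h n1) (b1 + 1) chi.
      by apply: bdd_le Hb1 => //; [exact: lev_gt0|rewrite lerDl].
    have [_ HQ] := Qbdd 0%N q a n1 b (b1 + 1) psi a0 spsi K1 Hb1' (addr_ge0 b10 ler01).
    rewrite P0; apply: le_trans (HB1 _ (b * k1) _ (QD 0%N q a psi a0 Hpsi) _) _.
    - by rewrite mulr_gt0.
    - have -> : b * k1 = b * (1 + 2 * 2 ^+ 0) ^+ q * (b1 + 1) * M 0%N.
        by rewrite /k1; ring.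
      exact: HQ.
    - have -> : (B1 * k1 + B2 * k2) * b = B1 * (b * k1) + B2 * k2 * b by ring.
      by rewrite lerDl; apply: mulr_ge0; [apply: mulr_ge0|]; exact: ltW.
  have j0 := s_gt0 j.+1.
  have Hb2' : bdd M (lev c (2 * h) n2) (b2 + 1) eta.
    apply: bdd_le Hb2 => //; [|by rewrite lerDl].
    by apply: lev_gt0; rewrite mulr_gt0.
  have HN n b' d : kbdd M q (lev c a n) b' psi -> bdd M (lev c (2 * h) n) d eta ->
      0 <= d -> csmooth (fmul (dil (2 ^+ j.+1) psi) eta) /\
      bdd M (lev c (2 * a + 2 * h) n) (b' * 3 ^+ q * (2 ^+ j.+1) ^+ q * d * M 0%N)
        (fmul (dil (2 ^+ j.+1) psi) eta).
    move=> Kn Kd d0; have l0 := lev_gt0 c n a0.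
    have b'0 := kbdd_ge0 _ _ _ _ l0 Kn.
    rewrite levD [lev c (2 * a) n]levM.
    apply: (bdd_fmul M_gt0 M1 cAnn) => //.
    - by rewrite mulr_gt0.
    - by apply: lev_gt0; rewrite mulr_gt0.
    - by case: (csmooth_dil (2 ^+ j.+1) spsi).
    - exact: kbdd_dil_annulus.
    - by rewrite !mulr_ge0// exprn_ge0// ltW.
  have [sN bN] := HN n2 b (b2 + 1) K2 Hb2' (addr_ge0 b20 ler01).
  have inN : inD M c (2 * a + 2 * h) (@annulus R) (fmul (dil (2 ^+ j.+1) psi) eta).
    split=> // [x /chi1_off Hx|n]; first by rewrite /fmul Hx mulr0.
    have [b' Hb'] := Hpsi.2 n; have [d d0 Hd] := Hchi1 n.
    by exists (b' * 3 ^+ q * (2 ^+ j.+1) ^+ q * d * M 0%N); case: (HN n b' d).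
  have cK : lcs_carrier (K_space c M) psi.
    by apply/(K_carrierP c M_gt0); exists q, a.
  have -> : f (P j.+1 psi) - f (P j psi) = f (P j.+1 psi - P j psi).
    have -> : P j.+1 psi - P j psi = (-1) *: P j psi + P j.+1 psi.
      by rewrite scaleN1r addrC.
    rewrite fD.1; [|exact: PD|exact: PD].
    by rewrite mulN1r addrC.
  rewrite Pdiff.
  have bpos : 0 < b * 3 ^+ q * (2 ^+ j.+1) ^+ q * (b2 + 1) * M 0%N.
    by rewrite !mulr_gt0// ?exprn_gt0// ltr_pwDr.
  apply: le_trans (HB2 j.+1 _ _ bpos inN bN) _.
  have -> : B2 * (b * 3 ^+ q * (2 ^+ j.+1) ^+ q * (b2 + 1) * M 0%N) / (2 ^+ j.+1) ^+ q.+1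
      = B2 * k2 * b / 2 ^+ j.+1.
    rewrite /k2 (exprS _ q); field.
    by rewrite !gt_eqF ?exprn_gt0.
  apply: ler_pM.
  - by apply: mulr_ge0; [apply: mulr_ge0|]; exact: ltW.
  - by rewrite invr_ge0 ltW.
  - by rewrite ler_wpM2r ?(ltW b0)// lerDr; apply: mulr_ge0; exact: ltW.
  - by rewrite lef_pV2 ?posrE// ler_weXn2l// ler1n.
have Hlim q a : 0 < a -> exists n B, forall b psi, 0 < b -> inK M c q a psi ->
    kbdd M q (lev c a n) b psi -> exists w, halving_lim (fun j => f (P j psi)) w /\
    cabs w <= B * b.
  (* One [B] bounds the first value [f (P 0 psi)], and [halving_cauchy] puts the limit within
     [4 * (B * b)] of it. *)
  move=> a0; have [n [B HB]] := key q a a0; exists n, (5 * B) => b psi b0 Hp Kp.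
  have [HB0 HBj] := HB b psi b0 Hp Kp.
  have [|w Hw] := halving_cauchy HBj.
    by move=> k; rewrite exprSr invfM mulrA.
  exists w; split; first by exists (4 * (B * b)) => j; rewrite -mulrA.
  rewrite -(subrK (f (P 0%N psi)) w); apply: le_trans (cabs_triangle _ _) _.
  have := Hw 0%N; rewrite expr0 divr1; lra.
(* [g] is the limit of [f] on the truncations [psi * chi (. / 2^j)]. *)
pose g psi : C := xget 0 [set w | halving_lim (fun j => f (P j psi)) w].
have gE psi w : halving_lim (fun j => f (P j psi)) w -> g psi = w.
  by move=> Hw; rewrite /g; apply: xget_unique => // w' Hw'; exact: halving_lim_uniq Hw' Hw.
have gK psi : lcs_carrier (K_space c M) psi -> halving_lim (fun j => f (P j psi)) (g psi).
  move=> /(K_carrierP c M_gt0)[q [a [a0 Hp]]].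
  have [n [B HB]] := Hlim q a a0; have [b Hb] := Hp.2 n.
  have b1 : 0 < `|b| + 1 by rewrite ltr_wpDl.
  have [|w [Hw _]] := HB (`|b| + 1) psi b1 Hp.
    apply: (kbddS M_gt0) Hb => //; first exact: lev_gt0.
    by apply: le_trans (ler_norm _) _; rewrite lerDl.
  by rewrite (gE _ _ Hw).
exists g.
  apply: (K_dualI M_gt0) => [z phi psi Hp Hq|q a a0].
    apply: gE; have := halving_lim_lin z (gK _ Hp) (gK _ Hq).
    by congr halving_lim; apply/funext => j; rewrite fPlin.
  have [n [B HB]] := Hlim q a a0; exists n, B => b psi b0 Hp Kp.
  by have [w [Hw wB]] := HB b psi b0 Hp Kp; rewrite (gE _ _ Hw).
move=> phi /(D_carrier_itvP c M_gt0)[A [a [A1 a0 [_ p0 _]]]].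
apply/esym/gE.
(* Once [2^j] exceeds [A], the cutoff equals 1 on the support of [phi], so the truncations are [phi]
   itself and the limit is [f phi]. *)
have [N HN] : exists N : nat, A < 2 ^+ N.
  exists (Num.truncn A).+1; apply: lt_trans (truncnS_gt _) _.
  by rewrite -natrX ltr_nat; exact: ltn_expl.
apply: (@halving_lim_eventually _ _ N) => j Nj; congr f; apply/funext => x.
rewrite /P; have [Ax|xA] := ltP A `|x|.
  by rewrite p0 ?mul0r// /= in_itv /= -ler_norml leNgt Ax.
rewrite chi1 ?mulr1// normrM gtr0_norm ?invr_gt0// ler_pdivrMl// mulr1.
apply: le_trans xA (le_trans (ltW HN) _).
by rewrite ler_weXn2l// ler1n.
Qed.

Lemma MAE_in_dual f : lcs_dual (D_space c M) f ->
  satisfies_MAE (D_space c M) f -> in_dual_of (K_space c M) (D_space c M) f.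
Proof.
move=> fD fMAE.
(* If all test functions vanish then [f] is the zero functional, so no
   nonquasianalyticity has to be proved. *)
have [[phi0 [x0 [Dphi0 phix0]]]|H] := pselect (exists phi0 x0,
    lcs_carrier (D_space c M) phi0 /\ phi0 x0 != 0).
  have [chi [h [schi h0 Hchi chi1 chi0]]] := exists_cutoff M_gt0 M1 Dphi0 phix0.
  exact: in_dual_of_cutoff Hchi chi1 chi0.
have D0 phi : lcs_carrier (D_space c M) phi -> phi = 0.
  move=> Dp; apply/funext => x; apply: contrapT => px; apply: H; exists phi, x.
  by split=> //; apply/eqP.
exists (fun _ => 0).
  apply: (K_dualI M_gt0) => [z phi psi _ _|q a _]; first by rewrite mulr0 addr0.
  by exists 0%N, 0 => b phi b0 _ _; rewrite cabs0 mul0r.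
move=> phi Dphi; have D00 := Dphi; rewrite (D0 _ Dphi) in D00 *.
exact: eq0_lin0 (fD.1 1 0 0 D00 D00).
Qed.

End extension.

Theorem theorem6 (R : realType) (M : nat -> R) (c : ultra_class)
  (f : (R -> R[i]) -> R[i])
  (M_gt0 : forall p : nat, 0 < M p)
  (M1 : weight_M1 M) (M2' : weight_M2' M) (M3' : weight_M3' M)
  (f_ud : lcs_dual (D_space c M) f) :
  satisfies_MAE (D_space c M) f
  <-> in_dual_of (K_space c M) (D_space c M) f.
Proof.
split; first exact: MAE_in_dual.
by move=> [g gK fg]; exact: MAE_of_dual gK fg.
Qed.
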